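(* Let $\theta\in\mathbb R\setminus\mathbb Q$. The periodic cyclic cohomology of $\mathcal A_\theta^{alg}\rtimes\mathbb Z_2$ satisfies $HC^{even}(\mathcal A_\theta^{alg}\rtimes\mathbb Z_2)\cong\mathbb C^6$ and $HC^{odd}(\mathcal A_\theta^{alg}\rtimes\mathbb Z_2)=0$.
   Context: Let $\lambda=e^{2\pi i\theta}$. The algebraic noncommutative torus $\mathcal A_\theta^{alg}$ is the complex algebra of finite linear combinations $\sum a_{n,m}U_1^nU_2^m$ generated by invertible $U_1,U_2$ with $U_2U_1=\lambda U_1U_2$. $\mathbb Z_2$ acts by the automorphism $\sigma(U_j)=U_j^{-1}$, and $\mathcal A_\theta^{alg}\rtimes\mathbb Z_2$ is generated by $\mathcal A_\theta^{alg}$ and $t$ with $t^2=1$, $tat=\sigma(a)$. $HC^{even}$, $HC^{odd}$ denote the even and odd periodic cyclic cohomology. *)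

(* Defs.v *)
From Stdlib Require Import Reals ZArith List Bool Arith.
Import ListNotations.
Open Scope R_scope.

Definition C : Type := (R * R)%type.
Definition C0 : C := (0, 0).
Definition C1 : C := (1, 0).
Definition Cadd (x y : C) : C := (fst x + fst y, snd x + snd y).
Definition Cmul (x y : C) : C :=
  (fst x * fst y - snd x * snd y, fst x * snd y + snd x * fst y).
Definition Copp (x : C) : C := (- fst x, - snd x).
Definition Csub (x y : C) : C := Cadd x (Copp y).
Definition Csign (n : nat) : C := if Nat.even n then C1 else Copp C1.

Definition lam_pow (theta : R) (k : Z) : C :=
  (cos (2 * PI * theta * IZR k), sin (2 * PI * theta * IZR k)).

(* Linear basis: (n, m, e) stands for U1^n U2^m t^e (e = true means t). *)
Definition Basis : Type := (Z * Z * bool)%type.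
Definition unitB : Basis := (0%Z, 0%Z, false).

(* Product of basis elements, as (scalar, basis element):
   U1^a U2^b t^e . U1^c U2^d t^f = U1^a U2^b sigma^e(U1^c U2^d) t^(e xor f)
   and U2^b U1^c' = lambda^(b c') U1^c' U2^b. *)
Definition mulB (theta : R) (x y : Basis) : C * Basis :=
  let '(a, b, e) := x in
  let '(c, d, f) := y in
  let c' := if e then (- c)%Z else c in
  let d' := if e then (- d)%Z else d in
  (lam_pow theta (b * c')%Z, ((a + c')%Z, (b + d')%Z, xorb e f)).

(* A linear functional on A^{(x)(n+1)} is determined by its (arbitrary) values on
   tuples of basis elements; a cochain of degree n is evaluated on lists of
   length n+1 (values on other lengths are irrelevant). *)
Definition cochain : Type := list Basis -> C.

Definition face (theta : R) (i : nat) (l : list Basis) : C * list Basis :=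
  let '(c, x) := mulB theta (nth i l unitB) (nth (S i) l unitB) in
  (c, firstn i l ++ x :: skipn (S (S i)) l).

Definition last_face (theta : R) (l : list Basis) : C * list Basis :=
  match l with
  | [] => (C1, [])
  | a0 :: rest =>
      let '(c, x) := mulB theta (last rest unitB) a0 in (c, x :: removelast rest)
  end.

Definition Csum (f : nat -> C) (n : nat) : C :=
  fold_right Cadd C0 (map f (seq 0 n)).

Definition hoch_b (theta : R) (n : nat) (phi : cochain) : cochain :=
  fun l =>
    Cadd (Csum (fun i => let '(c, l') := face theta i l in
                         Cmul (Csign i) (Cmul c (phi l'))) (S n))
         (let '(c, l') := last_face theta l in
          Cmul (Csign (S n)) (Cmul c (phi l'))).

(* Connes' operator B : C^{n+1} -> C^n on normalized cochains:
   (B phi)(a0..an) = sum_{i=0}^n (-1)^{n i} phi(1, a_i, ..., a_n, a_0, ..., a_{i-1}) *)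
Definition connes_B (n : nat) (phi : cochain) : cochain :=
  fun l => Csum (fun i => Cmul (Csign (n * i)) (phi (unitB :: skipn i l ++ firstn i l)))
                (S n).

Definition family : Type := nat -> cochain.

Definition fam_eq (f g : family) : Prop :=
  forall n l, length l = S n -> f n l = g n l.

Definition total_d (theta : R) (f : family) : family :=
  fun n l =>
    Cadd (match n with O => C0 | S k => hoch_b theta k (f k) l end)
         (connes_B n (f (S n)) l).

Definition normalized (f : family) : Prop :=
  forall n l, length l = S n ->
    (exists i, (1 <= i)%nat /\ (i <= n)%nat /\ nth i l unitB = unitB) -> f n l = C0.

Definition adm (p : bool) (f : family) : Prop :=
  normalized f /\
  (forall n l, length l = S n -> Nat.even n <> p -> f n l = C0) /\
  (exists N, forall n l, (N <= n)%nat -> length l = S n -> f n l = C0).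

Definition HP_cocycle (theta : R) (p : bool) (f : family) : Prop :=
  adm p f /\ fam_eq (total_d theta f) (fun _ _ => C0).

Definition HP_coboundary (theta : R) (p : bool) (f : family) : Prop :=
  adm p f /\ exists g, adm (negb p) g /\ fam_eq f (total_d theta g).

Definition fam_add (f g : family) : family := fun n l => Cadd (f n l) (g n l).
Definition fam_scale (a : C) (f : family) : family := fun n l => Cmul a (f n l).
Definition fam_sub (f g : family) : family := fun n l => Csub (f n l) (g n l).
Definition fam_zero : family := fun _ _ => C0.

Definition lin_comb (k : nat) (a : nat -> C) (c : nat -> family) : family :=
  fold_right fam_add fam_zero (map (fun i => fam_scale (a i) (c i)) (seq 0 k)).

(* HP^p(A_theta^alg x| Z_2) is isomorphic to C^k as a complex vector space:
   there are k cocycles whose classes form a basis of the cohomology. *)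
Definition HP_iso_Cn (theta : R) (p : bool) (k : nat) : Prop :=
  exists c : nat -> family,
    (forall i, (i < k)%nat -> HP_cocycle theta p (c i)) /\
    (forall a : nat -> C,
        HP_coboundary theta p (lin_comb k a c) -> forall i, (i < k)%nat -> a i = C0) /\
    (forall f, HP_cocycle theta p f ->
        exists a : nat -> C, HP_coboundary theta p (fam_sub f (lin_comb k a c))).

Definition HP_zero (theta : R) (p : bool) : Prop :=
  forall f, HP_cocycle theta p f -> HP_coboundary theta p f.

Definition irrational (theta : R) : Prop :=
  forall p q : Z, q <> 0%Z -> theta <> IZR p / IZR q.

(* Main.v *)
(** The crossed product is a twisted group algebra of [Z^2 x| Z_2], so its Hochschild cochains are
    functions on tuples of monomials; in homogeneous form they are group cochains [F (x0, .., xn; a)]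
    with coefficients in the functions of a monomial [a], acted on by conjugation. The cohomology of
    the lattice is computed by a double complex: cochains on vertices are contracted by a cone, and
    the Koszul complex of [U1 - 1], [U2 - 1] is exact on functions over a free orbit, because
    differences along an orbit can be summed, and on multiples of [U^v] with [v <> 0], because some
    [Uj] acts there by a scalar other than [1] when [theta] is irrational. Only the class of the unit
    obstructs: its contribution in degree 1 is killed by [t], which acts by [-1], and the one in
    degree 2 is a multiple of the area cocycle. Hence Hochschild cohomology vanishes in degree 1 and
    above degree 2, is a line in degree 2, and in degree 0 consists of the canonical trace and one
    trace for each of the four conjugacy classes of elements [U^v t]. Since [(b + B)^2 = 0], the top
    component of a periodic cocycle can be removed until only degrees at most 2 remain. *)

From Stdlib Require Import Reals ZArith List Bool Arith Lia Lra Ring Field FunctionalExtensionality.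
Require Import Defs.
Import ListNotations.

(* The scalars of the product are moved into a central variable of a group, and lambda enters only
   as the character by which the centre acts on coefficients. A homogeneous cochain is one function
   on tuples of all lengths, the empty one included. The empty tuple is the augmentation of the
   complex, and only there can the lattice fail to act freely; so each obstruction reduces to a few
   values of the cocycle at central monomials. The factor of order 2 costs an average over two
   elements. In the periodic complex cochains have finite support, so that the removal of top
   components can start. The components in degrees 0 and 2 interact: once the one in degree 2 is a
   multiple of the area cocycle plus [b h], it is the one in degree 0 minus [B h] that is a trace.
   The vanishing in degree 1 is used twice: it kills the odd cohomology, and it excludes relations
   between the five traces. *)
Declare Scope C_scope.
Delimit Scope C_scope with C.
Bind Scope C_scope with C.
Notation "0" := C0 : C_scope.
Notation "1" := C1 : C_scope.
Infix "+" := Cadd : C_scope.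
Infix "*" := Cmul : C_scope.
Infix "-" := Csub : C_scope.
Notation "- x" := (Copp x) : C_scope.
Open Scope C_scope.

(** * Complex scalars, signs and powers of lambda *)

Definition Cinv (x : C) : C :=
  (fst x / (fst x * fst x + snd x * snd x), - snd x / (fst x * fst x + snd x * snd x))%R.

Lemma C_ring_theory : ring_theory C0 C1 Cadd Cmul Csub Copp eq.
Proof.
  split; intros; repeat match goal with x : C |- _ => destruct x end;
    unfold Cadd, Cmul, Csub, Copp, Cadd, C0, C1; simpl; f_equal; ring.
Qed.

Lemma C_neq_0_norm (x : C) : x <> 0 -> (fst x * fst x + snd x * snd x <> 0)%R.
Proof.
  destruct x as [a b]; simpl; intros H E. apply H.
  assert (a = 0%R) by nra. assert (b = 0%R) by nra. subst; reflexivity.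
Qed.

Lemma Cinv_l (x : C) : x <> 0 -> Cinv x * x = 1.
Proof.
  intros H%C_neq_0_norm. destruct x as [a b]; unfold Cinv, Cmul, C1; simpl in *.
  f_equal; field; lra.
Qed.

Lemma C_field_theory :
  field_theory C0 C1 Cadd Cmul Csub Copp (fun x y => x * Cinv y) Cinv eq.
Proof.
  split.
  - exact C_ring_theory.
  - intros E; injection E; lra.
  - reflexivity.
  - exact Cinv_l.
Qed.

Add Field C_field : C_field_theory.

Lemma C2_neq_0 : 1 + 1 <> 0.
Proof. intros E; injection E; lra. Qed.

Lemma Cneg2_neq_0 : - (1 + 1) <> 0.
Proof. intros E; injection E; lra. Qed.

Lemma Cmul_0_l (x : C) : 0 * x = 0.
Proof. ring. Qed.

Lemma Cmul_neq_0 (x y : C) : x <> 0 -> x * y = 0 -> y = 0.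
Proof.
  intros Hx E. transitivity (Cinv x * (x * y)); [field; assumption|rewrite E; ring].
Qed.

Lemma Csub_diag_eq (x y : C) : x - y = 0 -> x = y.
Proof. intros E. transitivity (x - y + y); [ring|rewrite E; ring]. Qed.

Lemma Csign_S (n : nat) : Csign (S n) = - Csign n.
Proof.
  unfold Csign. rewrite Nat.even_succ, <- Nat.negb_even.
  destruct (Nat.even n); simpl; ring.
Qed.

Lemma Csign_add (m n : nat) : Csign (m + n) = Csign m * Csign n.
Proof.
  induction m as [|m IH]; simpl.
  - unfold Csign at 2; simpl; ring.
  - rewrite !Csign_S, IH; ring.
Qed.

Lemma Csign_sq (n : nat) : Csign n * Csign n = 1.
Proof. unfold Csign; destruct (Nat.even n); ring. Qed.

Lemma Csign_double (n : nat) : Csign (2 * n) = 1.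
Proof. replace (2 * n)%nat with (n + n)%nat by lia. now rewrite Csign_add, Csign_sq. Qed.

Lemma lam_pow_0 (theta : R) : lam_pow theta 0 = 1.
Proof. unfold lam_pow. rewrite Rmult_0_r, cos_0, sin_0. reflexivity. Qed.

Lemma lam_pow_add (theta : R) (j k : Z) :
  lam_pow theta (j + k) = lam_pow theta j * lam_pow theta k.
Proof.
  unfold lam_pow, Cmul; simpl. rewrite plus_IZR, Rmult_plus_distr_l, cos_plus, sin_plus.
  f_equal; ring.
Qed.

Lemma lam_pow_opp (theta : R) (k : Z) : lam_pow theta (- k) * lam_pow theta k = 1.
Proof. rewrite <- lam_pow_add, Z.add_opp_diag_l. apply lam_pow_0. Qed.

(** Imaginary parts suffice: a zero of the sine makes [2 * theta * k] an integer. *)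
Lemma lam_pow_neq_1 (theta : R) (Hirr : irrational theta) (k : Z) :
  k <> 0%Z -> lam_pow theta k - 1 <> 0.
Proof.
  intros Hk E%Csub_diag_eq. injection E as _ Hs.
  apply sin_eq_0_0 in Hs as [j Hj].
  apply (Hirr j (2 * k)%Z); [lia|].
  assert (HP := PI_RGT_0). assert (Hk' : IZR k <> 0%R) by (now apply not_0_IZR).
  rewrite mult_IZR. transitivity (2 * PI * theta * IZR k / (2 * IZR k * PI))%R.
  - field; lra.
  - rewrite Hj. field; lra.
Qed.

(** Monomials [z^k U1^a U2^b t^e] with [z] a formal central variable standing for lambda: a
    genuine group, so that the product needs no scalars. *)
Definition G : Type := (Z * Basis)%type.

Definition flip (e : bool) (x : Z) : Z := if e then (- x)%Z else x.

Definition mul (x y : G) : G :=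
  let '(k, (a, b, e)) := x in
  let '(k', (c, d, f)) := y in
  ((k + k' + b * flip e c)%Z, ((a + flip e c)%Z, (b + flip e d)%Z, xorb e f)).

Definition one : G := (0%Z, unitB).

(** A monomial with a factor [t] squares to a power of [z], so its inverse is proportional to
    itself; [a * b] comes from reordering [U1] and [U2]. *)
Definition inv (x : G) : G :=
  let '(k, (a, b, e)) := x in
  ((a * b - k)%Z, if e then (a, b, e) else ((- a)%Z, (- b)%Z, e)).

Definition zpow (k : Z) (x : G) : G := ((k + fst x)%Z, snd x).
Definition emb (x : Basis) : G := (0%Z, x).
Definition U1 : G := emb (1%Z, 0%Z, false).
Definition U2 : G := emb (0%Z, 1%Z, false).
Definition T : G := emb (0%Z, 0%Z, true).
Definition conj (g a : G) : G := mul (mul g a) (inv g).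

Ltac destruct_G :=
  repeat match goal with
    | x : G |- _ => destruct x as [? [[? ?] []]]
    | x : Basis |- _ => destruct x as [[? ?] []]
    end.
Ltac G_eq := intros; destruct_G; unfold conj, mul, inv, zpow, one, emb, flip, unitB;
  simpl; repeat match goal with |- (_, _) = (_, _) => apply f_equal2 end; try reflexivity; ring.

Lemma mul_assoc (x y z : G) : mul x (mul y z) = mul (mul x y) z.
Proof. G_eq. Qed.
Lemma mul_1_l (x : G) : mul one x = x.
Proof. G_eq. Qed.
Lemma mul_1_r (x : G) : mul x one = x.
Proof. G_eq. Qed.
Lemma mul_inv_l (x : G) : mul (inv x) x = one.
Proof. G_eq. Qed.
Lemma mul_inv_r (x : G) : mul x (inv x) = one.
Proof. G_eq. Qed.
Lemma zpow_mul_l (k : Z) (x y : G) : mul (zpow k x) y = zpow k (mul x y).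
Proof. G_eq. Qed.
Lemma zpow_mul_r (k : Z) (x y : G) : mul x (zpow k y) = zpow k (mul x y).
Proof. G_eq. Qed.
Lemma mul_inv_l_assoc (x y : G) : mul (inv x) (mul x y) = y.
Proof. now rewrite mul_assoc, mul_inv_l, mul_1_l. Qed.
Lemma mul_inv_r_assoc (x y : G) : mul x (mul (inv x) y) = y.
Proof. now rewrite mul_assoc, mul_inv_r, mul_1_l. Qed.
Lemma inv_mul (x y : G) : inv (mul x y) = mul (inv y) (inv x).
Proof. G_eq. Qed.
Lemma inv_zpow (k : Z) (x : G) : inv (zpow k x) = zpow (- k) (inv x).
Proof. G_eq. Qed.
Lemma inv_inv (x : G) : inv (inv x) = x.
Proof. G_eq. Qed.
Lemma conj_zpow (k : Z) (g a : G) : conj g (zpow k a) = zpow k (conj g a).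
Proof. G_eq. Qed.
Lemma conj_mul (g h a : G) : conj (mul g h) a = conj g (conj h a).
Proof. unfold conj. now rewrite inv_mul, !mul_assoc. Qed.
Lemma zpow_eq (x y : G) : snd x = snd y -> x = zpow (fst x - fst y) y.
Proof.
  destruct x, y; unfold zpow; simpl; intros ->. f_equal; ring.
Qed.
Lemma conj_snd (g h a : G) : snd g = snd h -> conj g a = conj h a.
Proof. destruct g, h; simpl; intros ->. G_eq. Qed.
Lemma mul_snd (x x' y y' : G) : snd x = snd x' -> snd y = snd y' -> snd (mul x y) = snd (mul x' y').
Proof. destruct x as [? [[? ?] ?]], x', y as [? [[? ?] ?]], y'; simpl; intros <- <-; reflexivity. Qed.
Lemma inv_snd (x x' : G) : snd x = snd x' -> snd (inv x) = snd (inv x').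
Proof. destruct x as [? [[? ?] ?]], x'; simpl; intros <-; reflexivity. Qed.
Lemma mulB_mul (theta : R) (x y : Basis) :
  mulB theta x y = (lam_pow theta (fst (mul (emb x) (emb y))), snd (mul (emb x) (emb y))).
Proof. destruct x as [[? ?] []], y as [[? ?] ?]; reflexivity. Qed.

Lemma central_eq (a : G) : snd a = unitB -> a = zpow (fst a) one.
Proof. destruct a; simpl; intros ->. unfold zpow; simpl. f_equal; lia. Qed.

Lemma conj_central (g a : G) : snd a = unitB -> conj g a = a.
Proof. intros H. rewrite (central_eq a H), conj_zpow. f_equal. G_eq. Qed.

(** * Exactness of the homogeneous complex *)

Arguments Z.add : simpl never.
Arguments Z.mul : simpl never.
Arguments Z.sub : simpl never.
Arguments Z.opp : simpl never.

(** The alternating sum over omitted entries. A list with one entry yields [f []], so this is the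
    augmented complex. *)
Fixpoint del {X : Type} (f : list X -> C) (l : list X) : C :=
  match l with
  | [] => 0
  | x :: l' => f l' - del (fun y => f (x :: y)) l'
  end.

Lemma del_ext {X} (f g : list X -> C) (l : list X) : (forall l, f l = g l) -> del f l = del g l.
Proof.
  intros H. f_equal. now apply functional_extensionality.
Qed.

Lemma del_0 {X} (l : list X) : del (fun _ => 0) l = 0.
Proof. induction l as [|x l IH]; simpl; [|rewrite IH]; ring. Qed.

Lemma del_sub {X} (f g : list X -> C) (l : list X) :
  del (fun y => f y - g y) l = del f l - del g l.
Proof.
  revert f g; induction l as [|x l IH]; intros f g; simpl; [ring|].
  rewrite (IH (fun y => f (x :: y)) (fun y => g (x :: y))). ring.
Qed.

Lemma del_scale {X} (c : C) (f : list X -> C) (l : list X) :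
  del (fun y => c * f y) l = c * del f l.
Proof.
  revert f; induction l as [|x l IH]; intros f; simpl; [ring|].
  rewrite (IH (fun y => f (x :: y))). ring.
Qed.

Lemma del_del {X} (f : list X -> C) (l : list X) : del (del f) l = 0.
Proof.
  revert f; induction l as [|x l IH]; intros f; simpl; [reflexivity|].
  rewrite del_sub, IH. ring.
Qed.

Lemma del_map {X Y} (h : X -> Y) (f : list Y -> C) (l : list X) :
  del (fun y => f (map h y)) l = del f (map h l).
Proof.
  revert f; induction l as [|x l IH]; intros f; simpl; [reflexivity|].
  now rewrite <- (IH (fun y => f (h x :: y))).
Qed.

Fixpoint degen (X : list G) : Prop :=
  match X with
  | x :: X' => match X' with y :: _ => snd x = snd y | [] => False end \/ degen X'
  | [] => False
  end.

Lemma degen_map (g : G) (X : list G) : degen X -> degen (map (mul g) X).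
Proof.
  induction X as [|x [|y X] IH]; simpl; auto.
  intros [H|H]; [left|right]; [now apply mul_snd|now apply IH].
Qed.

(** Omitting either of the two equal neighbours gives terms that cancel, because [f] sees vertices
    only modulo [z]; the other terms stay degenerate. *)
Lemma del_degen (f : list G -> C) :
  (forall X X' : list G, map snd X = map snd X' -> f X = f X') ->
  (forall X, degen X -> f X = 0) -> forall X, degen X -> del f X = 0.
Proof.
  intros Hs Hf X; revert f Hs Hf; induction X as [|x X IH]; intros f Hs Hf; [easy|].
  intros [E|H].
  - destruct X as [|y X]; [easy|]. simpl.
    rewrite (del_ext _ (fun _ => 0)), del_0.
    + simpl in E. rewrite (Hs (y :: X) (x :: X)) by (simpl; congruence). ring.
    + intros Y. apply Hf. simpl; auto.
  - simpl. rewrite IH, Hf; [ring|assumption| | |assumption].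
    + intros Y Y' EY. apply Hs. simpl; congruence.
    + intros Y HY. apply Hf. simpl; auto.
Qed.

Lemma del_snd (c : C) (f f' : list G -> C) :
  (forall X X' : list G, map snd X = map snd X' -> f X = c * f' X') ->
  forall X X' : list G, map snd X = map snd X' -> del f X = c * del f' X'.
Proof.
  intros Hs X; revert f f' Hs; induction X as [|x X IH]; intros f f' Hs [|x' X'];
    simpl; try easy.
  - intros _; ring.
  - intros E; injection E as E E'. rewrite (Hs X X' E').
    rewrite (IH _ (fun y => f' (x' :: y))) with (X' := X'); [ring| |exact E'].
    intros Y Y' EY. apply Hs. simpl; congruence.
Qed.

(** Homogeneous cochains: [X] is a tuple of vertices, [a] the argument in the coefficient module. *)
Definition fn : Type := list G -> G -> C.
Definition f0 : fn := fun _ _ => 0.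
Definition fsub (F H : fn) : fn := fun X a => F X a - H X a.
Definition fadd (F H : fn) : fn := fun X a => F X a + H X a.
Definition fscale (c : C) (F : fn) : fn := fun X a => c * F X a.
Definition dl (F : fn) : fn := fun X a => del (fun Y => F Y a) X.
Definition cone (F : fn) : fn := fun X a => F (one :: X) a.
Definition tr (g : G) (F : fn) : fn := fun X a => F (map (mul g) X) (conj g a).
Definition D (g : G) (F : fn) : fn := fsub (tr g F) F.

Ltac fn_ext := intros; apply functional_extensionality; intros ?X;
  apply functional_extensionality; intros ?a.

Lemma dl_sub (F H : fn) : dl (fsub F H) = fsub (dl F) (dl H).
Proof. fn_ext. apply del_sub. Qed.
Lemma dl_scale (c : C) (F : fn) : dl (fscale c F) = fscale c (dl F).
Proof. fn_ext. apply (del_scale c (fun Y => F Y a)). Qed.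
Lemma dl_dl (F : fn) : dl (dl F) = f0.
Proof. fn_ext. apply (del_del (fun Y => F Y a)). Qed.
Lemma dl_tr (g : G) (F : fn) : dl (tr g F) = tr g (dl F).
Proof. fn_ext. apply (del_map (mul g) (fun Y => F Y (conj g a))). Qed.
Lemma dl_D (g : G) (F : fn) : dl (D g F) = D g (dl F).
Proof. unfold D. now rewrite dl_sub, dl_tr. Qed.
Lemma D_sub (g : G) (F H : fn) : D g (fsub F H) = fsub (D g F) (D g H).
Proof. fn_ext. unfold D, fsub, tr. ring. Qed.
Lemma dl_cone (F : fn) : dl F = f0 -> dl (cone F) = F.
Proof.
  fn_ext. assert (E := equal_f (equal_f H (one :: X)) a).
  unfold dl in *; simpl in E. symmetry. now apply Csub_diag_eq.
Qed.
Lemma tr_mul (g h : G) (F : fn) : tr (mul g h) F = tr h (tr g F).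
Proof.
  fn_ext. unfold tr. rewrite conj_mul, map_map. f_equal.
  apply map_ext. intros. symmetry. apply mul_assoc.
Qed.
Lemma tr_one (F : fn) : tr one F = F.
Proof.
  fn_ext. unfold tr. f_equal.
  - rewrite <- map_id. apply map_ext. apply mul_1_l.
  - G_eq.
Qed.
Lemma tr_inv (g : G) (F : fn) : tr g F = F -> tr (inv g) F = F.
Proof. intros H. rewrite <- H at 1. now rewrite <- tr_mul, mul_inv_r, tr_one. Qed.

Section Theta.
Variable theta : R.

(** Cochains of the twisted group algebra: [z] acts by lambda in the coefficient and trivially on
    the vertices. The second field is normalization, since neighbours equal modulo [z] correspond to
    a unit among the arguments. *)
Record regular (F : fn) : Prop := {
  reg_z : forall (X X' : list G) a k, map snd X = map snd X' ->
    F X (zpow k a) = lam_pow theta k * F X' a;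
  reg_n : forall X a, degen X -> F X a = 0 }.

Lemma zpow_0 (a : G) : zpow 0 a = a.
Proof. now destruct a. Qed.

Lemma reg_snd (F : fn) (X X' : list G) (a : G) :
  regular F -> map snd X = map snd X' -> F X a = F X' a.
Proof.
  intros HF E. rewrite <- (zpow_0 a) at 1. rewrite (reg_z F HF _ _ _ _ E), lam_pow_0. ring.
Qed.

Lemma regular_sub (F H : fn) : regular F -> regular H -> regular (fsub F H).
Proof.
  intros [F1 F2] [H1 H2]; split; unfold fsub; intros.
  - rewrite (F1 _ X'), (H1 _ X') by assumption; ring.
  - rewrite F2, H2 by assumption; ring.
Qed.

Lemma regular_add (F H : fn) : regular F -> regular H -> regular (fadd F H).
Proof.
  intros [F1 F2] [H1 H2]; split; unfold fadd; intros.
  - rewrite (F1 _ X'), (H1 _ X') by assumption; ring.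
  - rewrite F2, H2 by assumption; ring.
Qed.

Lemma regular_weight (c : list Basis -> Basis -> C) (F : fn) :
  regular F -> regular (fun X a => c (map snd X) (snd a) * F X a).
Proof.
  intros [F1 F2]; split; intros.
  - rewrite (F1 _ X'), H by assumption; simpl; ring.
  - rewrite F2 by assumption; ring.
Qed.

Lemma regular_tr (g : G) (F : fn) : regular F -> regular (tr g F).
Proof.
  intros [F1 F2]; split; unfold tr; intros.
  - rewrite conj_zpow. apply F1. revert X' H.
    induction X as [|x X IH]; intros [|x' X']; simpl; try easy.
    intros E; injection E as E E'. f_equal; auto using mul_snd.
  - auto using degen_map.
Qed.

Lemma regular_D (g : G) (F : fn) : regular F -> regular (D g F).
Proof. intros H. apply regular_sub; [now apply regular_tr|exact H]. Qed.

Lemma regular_cone (F : fn) : regular F -> regular (cone F).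
Proof.
  intros [F1 F2]; split; unfold cone; intros.
  - apply F1. simpl; congruence.
  - apply F2. simpl; auto.
Qed.

Lemma tr_snd (g h : G) (F : fn) : regular F -> snd g = snd h -> tr g F = tr h F.
Proof.
  intros HF E. fn_ext. unfold tr. rewrite (conj_snd g h a E).
  apply reg_snd; [exact HF|]. rewrite !map_map. apply map_ext. intros. now apply mul_snd.
Qed.

(** [U1] and [U2] commute up to [z], and translation by [z] does not change a regular cochain. *)
Lemma D_comm (F : fn) : regular F -> D U1 (D U2 F) = D U2 (D U1 F).
Proof.
  intros HF. assert (E : tr U1 (tr U2 F) = tr U2 (tr U1 F)).
  { rewrite <- !tr_mul. apply tr_snd; auto. }
  fn_ext. assert (E' := equal_f (equal_f E X) a). revert E'. unfold D, fsub, tr.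
  intros ->. ring.
Qed.

Lemma regular_dl (F : fn) : regular F -> regular (dl F).
Proof.
  intros [F1 F2]; split; unfold dl; intros.
  - revert X X' H. apply del_snd. intros; now apply F1.
  - revert X H. apply del_degen; [|auto].
    intros; apply reg_snd; [split|]; assumption.
Qed.

(* The sum along an orbit of [s] starts where [n] vanishes. *)
Section Antidifference.
Variables (Y : Type) (s s' : Y -> Y) (n : Y -> Z) (F : Y -> C).

Fixpoint sum_back (m : nat) (y : Y) : C :=
  match m with O => 0 | S m => F (s' y) + sum_back m (s' y) end.
Fixpoint sum_forth (m : nat) (y : Y) : C :=
  match m with O => 0 | S m => sum_forth m (s y) - F y end.
Definition antidiff (y : Y) : C :=
  if (0 <=? n y)%Z then sum_back (Z.to_nat (n y)) y else sum_forth (Z.to_nat (- n y)) y.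

Lemma antidiff_spec (y : Y) :
  s' (s y) = y -> n (s y) = (n y + 1)%Z -> antidiff (s y) - antidiff y = F y.
Proof.
  intros Hs Hn. unfold antidiff. rewrite Hn.
  destruct (Z.leb_spec 0 (n y)) as [H|H].
  - replace (0 <=? n y + 1)%Z with true by (symmetry; apply Z.leb_le; lia).
    replace (Z.to_nat (n y + 1)) with (S (Z.to_nat (n y))) by lia.
    simpl. rewrite Hs. ring.
  - replace (Z.to_nat (- n y)) with (S (Z.to_nat (- (n y + 1)))) by lia. simpl.
    destruct (Z.leb_spec 0 (n y + 1)).
    + replace (n y + 1)%Z with 0%Z by lia. simpl. ring.
    + ring.
Qed.

(** Serves three times: with [c] a power of lambda for equivariance, with [c = 0] for normalization,
    with [c = 1] for invariance under [U1]. *)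
Lemma antidiff_rel (r : Y -> Y -> Prop) (c : C) :
  (forall y z, r y z -> r (s y) (s z)) ->
  (forall y z, r y z -> r (s' y) (s' z)) ->
  (forall y z, r y z -> n z = n y) ->
  (forall y z, r y z -> F z = c * F y) ->
  forall y z, r y z -> antidiff z = c * antidiff y.
Proof.
  intros Hs Hs' Hn HF y z Hr. unfold antidiff. rewrite (Hn y z Hr).
  destruct (0 <=? n y)%Z.
  - generalize (Z.to_nat (n y)) as m. intros m; revert y z Hr.
    induction m as [|m IH]; intros y z Hr; simpl; [ring|].
    rewrite (IH (s' y)) by auto. rewrite (HF (s' y)) by auto. ring.
  - generalize (Z.to_nat (- n y)) as m. intros m; revert y z Hr.
    induction m as [|m IH]; intros y z Hr; simpl; [ring|].
    rewrite (IH (s y)) by auto. rewrite (HF y) by auto. ring.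
Qed.
End Antidifference.

(** * Primitives along the orbits of the lattice *)

Definition coord1 (x : G) : Z := fst (fst (snd x)).
Definition coord2 (x : G) : Z := snd (fst (snd x)).

(* A monomial with a factor [t] moves by two steps under conjugation, hence the halving. *)
Definition level (cd : G -> Z) (y : list G * G) : Z :=
  match fst y with
  | x :: _ => cd x
  | [] => (cd (snd y) / 2)%Z
  end.

Definition shift (g : G) (y : list G * G) : list G * G :=
  (map (mul g) (fst y), conj g (snd y)).

(* Excludes the points where the lattice acts by scalars instead of freely. *)
Definition free_at {X} (l : list X) (a : Basis) : bool :=
  match l with [] => snd a | _ => true end.

Definition prim (g : G) (cd : G -> Z) (F : fn) : fn := fun X a =>
  antidiff _ (shift g) (shift (inv g)) (level cd) (fun y => F (fst y) (snd y)) (X, a).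

Lemma shift_inv_l (g : G) (y : list G * G) : shift (inv g) (shift g y) = y.
Proof.
  destruct y as [X a]; unfold shift; simpl. f_equal.
  - rewrite map_map. rewrite <- map_id. apply map_ext. apply mul_inv_l_assoc.
  - rewrite <- conj_mul, mul_inv_l. G_eq.
Qed.

Definition steps (g : G) (cd : G -> Z) : Prop :=
  forall y, free_at (fst y) (snd (snd y)) = true -> level cd (shift g y) = (level cd y + 1)%Z.

Lemma steps_U1 : steps U1 coord1.
Proof.
  intros [[|[? [[? ?] ?]] X] [? [[? ?] ?]]]; simpl; intros H; unfold level; simpl.
  - subst b; unfold conj, coord1; simpl. rewrite <- Z.div_add by lia. f_equal. lia.
  - unfold coord1; simpl; lia.
Qed.

Lemma steps_U2 : steps U2 coord2.
Proof.
  intros [[|[? [[? ?] ?]] X] [? [[? ?] ?]]]; simpl; intros H; unfold level; simpl.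
  - subst b; unfold conj, coord2; simpl. rewrite <- Z.div_add by lia. f_equal; lia.
  - unfold coord2; simpl; lia.
Qed.

Lemma level_snd (cd : G -> Z) (X X' : list G) (a a' : G) :
  (forall x y, snd x = snd y -> cd x = cd y) ->
  map snd X = map snd X' -> snd a = snd a' -> level cd (X, a) = level cd (X', a').
Proof.
  intros H. unfold level; destruct X, X'; simpl; try easy; intros.
  - f_equal; auto.
  - apply H; congruence.
Qed.

Lemma map_mul_snd (g : G) (X X' : list G) :
  map snd X = map snd X' -> map snd (map (mul g) X) = map snd (map (mul g) X').
Proof.
  revert X'; induction X as [|x X IH]; intros [|x' X']; simpl; try easy.
  intros E; injection E as E E'. f_equal; auto using mul_snd.
Qed.

Lemma prim_regular (g : G) (cd : G -> Z) (F : fn) :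
  (forall x y, snd x = snd y -> cd x = cd y) -> regular F -> regular (prim g cd F).
Proof.
  intros Hcd [F1 F2]; split; unfold prim; intros.
  - apply antidiff_rel with (r := fun y z =>
      map snd (fst z) = map snd (fst y) /\ snd z = zpow k (snd y)).
    + intros [Y b] [Y' b'] [E E']; unfold shift in *; cbn [fst snd] in *; subst b'.
      split; auto using map_mul_snd, conj_zpow.
    + intros [Y b] [Y' b'] [E E']; unfold shift in *; cbn [fst snd] in *; subst b'.
      split; auto using map_mul_snd, conj_zpow.
    + intros [Y b] [Y' b'] [E E']; unfold shift in *; cbn [fst snd] in *; subst b'. now apply level_snd.
    + intros [Y b] [Y' b'] [E E']; unfold shift in *; cbn [fst snd] in *; subst b'. now apply F1.
    + simpl; auto.
  - rewrite <- (Cmul_0_l (prim g cd F X a)). unfold prim.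
    apply antidiff_rel with (r := fun y z => y = z /\ degen (fst y)).
    + intros y z [-> Hd]; split; [reflexivity|]. now apply degen_map.
    + intros y z [-> Hd]; split; [reflexivity|]. now apply degen_map.
    + intros y z [-> Hd]; reflexivity.
    + intros y z [-> Hd]. rewrite F2 by assumption. ring.
    + auto.
Qed.

Lemma prim_spec (g : G) (cd : G -> Z) (F : fn) (X : list G) (a : G) :
  steps g cd -> free_at X (snd a) = true -> D g (prim g cd F) X a = F X a.
Proof.
  intros Hs H. apply (antidiff_spec _ (shift g) (shift (inv g)) (level cd)
    (fun y => F (fst y) (snd y)) (X, a)); [apply shift_inv_l|now apply Hs].
Qed.

Lemma free_at_shift (g : G) (X : list G) (a : G) :
  free_at (map (mul g) X) (snd (conj g a)) = free_at X (snd a).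
Proof.
  destruct X; [|reflexivity]. simpl. destruct_G; reflexivity.
Qed.

(** [U1] preserves [coord2], hence the points where the sums along [U2] start. The relation compares
    vertices modulo [z] because [U1] and [U2] do not commute in [G]. *)
Lemma prim_U2_invariant (F : fn) (X : list G) (a : G) :
  regular F -> (forall X a, free_at X (snd a) = true -> D U1 F X a = 0) ->
  free_at X (snd a) = true -> D U1 (prim U2 coord2 F) X a = 0.
Proof.
  intros HF Hinv H. unfold D, fsub, tr.
  transitivity (1 * prim U2 coord2 F X a - prim U2 coord2 F X a); [|ring]. f_equal.
  apply antidiff_rel with (r := fun y z => free_at (fst y) (snd (snd y)) = true /\
    map snd (fst z) = map snd (map (mul U1) (fst y)) /\ snd z = conj U1 (snd y)).
  - intros [Y b] [Y' b'] [Hb [E E']]; unfold shift in *; cbn [fst snd] in *; subst b'.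
    split; [now rewrite free_at_shift|split].
    + rewrite (map_mul_snd U2 _ _ E), !map_map. apply map_ext. intros x.
      rewrite !mul_assoc. now apply mul_snd.
    + rewrite <- !conj_mul. now apply conj_snd.
  - intros [Y b] [Y' b'] [Hb [E E']]; unfold shift in *; cbn [fst snd] in *; subst b'.
    split; [now rewrite free_at_shift|split].
    + rewrite (map_mul_snd (inv U2) _ _ E), !map_map. apply map_ext. intros x.
      rewrite !mul_assoc. now apply mul_snd.
    + rewrite <- !conj_mul. now apply conj_snd.
  - intros [Y b] [Y' b'] [Hb [E E']]; unfold shift in *; cbn [fst snd] in *; subst b'.
    transitivity (level coord2 (map (mul U1) Y, conj U1 b)).
    + apply level_snd; auto. unfold coord2; congruence.
    + unfold level. destruct Y as [|[? [[? ?] ?]] ?]; simpl.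
      * simpl in Hb. destruct b as [? [[? ?] ?]]; simpl in *; subst. unfold coord2; simpl. f_equal; lia.
      * reflexivity.
  - intros [Y b] [Y' b'] [Hb [E E']]; unfold shift in *; cbn [fst snd] in *; subst b'.
    rewrite (reg_snd _ _ _ _ HF E). assert (Hi := Hinv Y b Hb).
    apply Csub_diag_eq in Hi. unfold tr in Hi. rewrite Hi. ring.
  - simpl; auto.
Qed.

(** * Exactness of the Koszul complex of the lattice *)

Lemma conj_U1_untwisted (a : G) : snd (snd a) = false -> conj U1 a = zpow (- coord2 a) a.
Proof. destruct a as [? [[? ?] e]]; simpl; intros ->. unfold coord2; simpl. G_eq. Qed.

Lemma conj_U2_untwisted (a : G) : snd (snd a) = false -> conj U2 a = zpow (coord1 a) a.
Proof. destruct a as [? [[? ?] e]]; simpl; intros ->. unfold coord1; simpl. G_eq. Qed.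

Lemma D_U1_untwisted (F : fn) (a : G) : regular F -> snd (snd a) = false ->
  D U1 F [] a = (lam_pow theta (- coord2 a) - 1) * F [] a.
Proof.
  intros HF Ha. unfold D, fsub, tr. simpl. rewrite (conj_U1_untwisted a Ha).
  rewrite (reg_z F HF [] [] a _ eq_refl). ring.
Qed.

Lemma D_U2_untwisted (F : fn) (a : G) : regular F -> snd (snd a) = false ->
  D U2 F [] a = (lam_pow theta (coord1 a) - 1) * F [] a.
Proof.
  intros HF Ha. unfold D, fsub, tr. simpl. rewrite (conj_U2_untwisted a Ha).
  rewrite (reg_z F HF [] [] a _ eq_refl). ring.
Qed.

Lemma free_at_map (X : list G) (a : Basis) : free_at (map snd X) a = free_at X a.
Proof. now destruct X. Qed.

(** Glues a primitive on the free points to a division by scalars on the others, [f] holding the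
    inverses. The case distinction reads only [snd], so that regularity survives. *)
Definition patch (F : fn) (f : Z -> Z -> C) (H : fn) : fn :=
  fadd (fun X a => (if free_at (map snd X) (snd a) then 1 else 0) * F X a)
       (fun X a => (if free_at (map snd X) (snd a) then 0
                    else f (fst (fst (snd a))) (snd (fst (snd a)))) * H X a).

Lemma patch_regular (F : fn) (f : Z -> Z -> C) (H : fn) :
  regular F -> regular H -> regular (patch F f H).
Proof.
  intros. apply regular_add.
  - apply (regular_weight (fun X a => if free_at X a then 1 else 0)); assumption.
  - apply (regular_weight (fun X a => if free_at X a then 0 else f (fst (fst a)) (snd (fst a))));
      assumption.
Qed.

Lemma patch_free (F : fn) (f : Z -> Z -> C) (H : fn) (X : list G) (a : G) :
  free_at X (snd a) = true -> patch F f H X a = F X a.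
Proof. intros E. unfold patch, fadd. rewrite free_at_map, E. ring. Qed.

Lemma patch_untwisted (F : fn) (f : Z -> Z -> C) (H : fn) (a : G) :
  snd (snd a) = false -> patch F f H [] a = f (coord1 a) (coord2 a) * H [] a.
Proof. intros E. unfold patch, fadd. simpl. rewrite E. unfold coord1, coord2. ring. Qed.

Lemma D_patch_free (g : G) (F : fn) (f : Z -> Z -> C) (H : fn) (X : list G) (a : G) :
  free_at X (snd a) = true -> D g (patch F f H) X a = D g F X a.
Proof.
  intros E. unfold D, fsub, tr. rewrite !patch_free; rewrite ?free_at_shift; auto.
Qed.

Lemma not_free (X : list G) (a : G) :
  free_at X (snd a) = false -> X = [] /\ snd (snd a) = false.
Proof. now destruct X. Qed.

Lemma coords_0 (a : G) :
  coord1 a = 0%Z -> coord2 a = 0%Z -> snd (snd a) = false -> snd a = unitB.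
Proof.
  destruct a as [? [[? ?] ?]]; unfold coord1, coord2; simpl; intros -> -> ->; reflexivity.
Qed.

Hypothesis Hirr : irrational theta.

Lemma koszul_top (F : fn) :
  regular F -> (forall a, snd a = unitB -> F [] a = 0) ->
  exists Q Q', regular Q /\ regular Q' /\ F = fsub (D U1 Q) (D U2 Q').
Proof.
  intros HF Hc.
  assert (HP : regular (prim U1 coord1 F)).
  { apply prim_regular; [unfold coord1; congruence|assumption]. }
  (* On [U1^n U2^m] the action of [U1] is by [lambda^(-m)] and that of [U2] by [lambda^n]: divide by
     the first difference if [m] is nonzero, else by the second. At the unit [F] vanishes, so any
     value does. *)
  pose (f (n m : Z) := if (m =? 0)%Z then 0 else Cinv (lam_pow theta (- m) - 1)).
  pose (f' (n m : Z) := if (m =? 0)%Z then - Cinv (lam_pow theta n - 1) else 0).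
  exists (patch (prim U1 coord1 F) f F), (patch (fscale 0 F) f' F).
  assert (H0 : regular (fscale 0 F)).
  { apply (regular_weight (fun _ _ => 0)), HF. }
  split; [|split]; try (now apply patch_regular).
  fn_ext. unfold fsub at 1. destruct (free_at X (snd a)) eqn:E.
  - rewrite !D_patch_free, prim_spec by auto using steps_U1.
    unfold D, fsub, tr, fscale. ring.
  - apply not_free in E as [-> E].
    rewrite D_U1_untwisted, D_U2_untwisted, !patch_untwisted by auto using patch_regular.
    unfold f, f'. destruct (Z.eqb_spec (coord2 a) 0) as [E2|E2].
    + destruct (Z.eq_dec (coord1 a) 0) as [E1|E1].
      * rewrite (Hc a) by auto using coords_0. ring.
      * field. now apply lam_pow_neq_1.
    + field. apply lam_pow_neq_1; [assumption|lia].
Qed.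

(** On free points, integrate [F1] along [U1]; by compatibility the remainder of [F2] is
    [U1]-invariant, so integrating it along [U2] leaves the first equation intact. *)
Lemma koszul_middle (F1 F2 : fn) :
  regular F1 -> regular F2 -> D U1 F2 = D U2 F1 ->
  (forall a, snd a = unitB -> F1 [] a = 0 /\ F2 [] a = 0) ->
  exists W, regular W /\ F1 = D U1 W /\ F2 = D U2 W.
Proof.
  intros HF1 HF2 HD Hc.
  pose (A := prim U1 coord1 F1).
  assert (HA : regular A).
  { apply prim_regular; [unfold coord1; congruence|assumption]. }
  pose (F3 := fsub F2 (D U2 A)).
  assert (HF3 : regular F3) by (unfold F3; auto using regular_sub, regular_D).
  assert (Hinv : forall X a, free_at X (snd a) = true -> D U1 F3 X a = 0).
  { intros X a E. unfold F3. rewrite D_sub, HD, D_comm by assumption.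
    rewrite <- D_sub. unfold D at 1, fsub, tr.
    unfold A. rewrite !prim_spec; rewrite ?free_at_shift; auto using steps_U1. ring. }
  pose (B := prim U2 coord2 F3).
  assert (HB : regular B).
  { apply prim_regular; [unfold coord2; congruence|assumption]. }
  pose (f1 (n m : Z) := if (m =? 0)%Z then 0 else Cinv (lam_pow theta (- m) - 1)).
  pose (f2 (n m : Z) := if (m =? 0)%Z then Cinv (lam_pow theta n - 1) else 0).
  assert (HAB : regular (fadd A B)) by auto using regular_add.
  (* Two patches, because off the free points it is [F1] or [F2] that gets divided, according to
     [coord2]; only the first carries the primitive on free points. *)
  exists (fadd (patch (fadd A B) f1 F1) (patch (fscale 0 F1) f2 F2)).
  assert (H0 : regular (fscale 0 F1)).
  { apply (regular_weight (fun _ _ => 0)), HF1. }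
  assert (HW : regular (fadd (patch (fadd A B) f1 F1) (patch (fscale 0 F1) f2 F2))).
  { apply regular_add; now apply patch_regular. }
  split; [assumption|].
  assert (Hfree : forall g X a, free_at X (snd a) = true ->
    D g (fadd (patch (fadd A B) f1 F1) (patch (fscale 0 F1) f2 F2)) X a = D g A X a + D g B X a).
  { intros g X a E. transitivity (D g (patch (fadd A B) f1 F1) X a + D g (patch (fscale 0 F1) f2 F2) X a).
    - unfold D, fsub, tr, fadd. ring.
    - rewrite !D_patch_free by assumption. unfold D, fsub, tr, fadd, fscale. ring. }
  split; fn_ext; destruct (free_at X (snd a)) eqn:E.
  - rewrite Hfree by assumption. unfold A at 1, B.
    rewrite prim_spec, prim_U2_invariant by auto using steps_U1. ring.
  - apply not_free in E as [-> E]. rewrite D_U1_untwisted by assumption.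
    unfold fadd at 1. rewrite !patch_untwisted by assumption. unfold f1, f2.
    assert (HD' := equal_f (equal_f HD []) a).
    rewrite D_U1_untwisted, D_U2_untwisted in HD' by assumption.
    destruct (Z.eqb_spec (coord2 a) 0) as [E2|E2].
    + rewrite E2 in *. change (- 0)%Z with 0%Z in *. rewrite lam_pow_0 in *.
      destruct (Z.eq_dec (coord1 a) 0) as [E1|E1].
      * destruct (Hc a) as [-> ->]; [now apply coords_0|]. ring.
      (* Here [U1] acts trivially and [U2] does not, so compatibility forces [F1] to vanish. *)
      * assert (F1 [] a = 0) as ->; [|ring].
        apply (Cmul_neq_0 (lam_pow theta (coord1 a) - 1)); [now apply lam_pow_neq_1|].
        rewrite <- HD'. ring.
    + field. apply lam_pow_neq_1; [assumption|lia].
  - rewrite Hfree by assumption. unfold B. rewrite prim_spec by auto using steps_U2.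
    unfold F3, fsub. ring.
  - apply not_free in E as [-> E]. rewrite D_U2_untwisted by assumption.
    unfold fadd at 1. rewrite !patch_untwisted by assumption. unfold f1, f2.
    assert (HD' := equal_f (equal_f HD []) a).
    rewrite D_U1_untwisted, D_U2_untwisted in HD' by assumption.
    destruct (Z.eqb_spec (coord2 a) 0) as [E2|E2].
    + destruct (Z.eq_dec (coord1 a) 0) as [E1|E1].
      * destruct (Hc a) as [-> ->]; [now apply coords_0|]. ring.
      * field. now apply lam_pow_neq_1.
    + transitivity (Cinv (lam_pow theta (- coord2 a) - 1) * ((lam_pow theta (- coord2 a) - 1) * F2 [] a)).
      * field. apply lam_pow_neq_1; [assumption|lia].
      * rewrite HD'. ring.
Qed.

Lemma D_0 (g : G) (F : fn) : tr g F = F -> D g F = f0.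
Proof. intros E. unfold D. rewrite E. fn_ext. unfold fsub, f0. ring. Qed.

Lemma fsub_diag_eq (F H : fn) : fsub F H = f0 -> F = H.
Proof. intros E. fn_ext. apply Csub_diag_eq. exact (equal_f (equal_f E X) a). Qed.

Lemma fsub_0 (F : fn) : fsub F f0 = F.
Proof. fn_ext. unfold fsub, f0. ring. Qed.

(* A zigzag in the double complex whose rows are contracted by [cone] and whose columns are the
   Koszul complex of [U1], [U2], exact by [koszul_top] and [koszul_middle]. *)
Lemma exact_lattice (F : fn) :
  regular F -> dl F = f0 -> tr U1 F = F -> tr U2 F = F ->
  (forall a, snd a = unitB -> F [one; U1] a = 0 /\ F [one; U2] a = 0) ->
  (forall a, snd a = unitB -> F [one; U2; mul U2 U1] a = F [one; U1; mul U1 U2] a) ->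
  exists E, regular E /\ tr U1 E = E /\ tr U2 E = E /\ dl E = F.
Proof.
  intros HF Hd HU1 HU2 Hc1 Hc2.
  pose (E := cone F). assert (HE : regular E) by (now apply regular_cone).
  assert (dE : dl E = F) by (now apply dl_cone).
  (* [F] is invariant, so [D U1 E] and [D U2 E] are closed and can be contracted in turn; [E12]
     measures how far the results are from being compatible. *)
  pose (E1 := cone (D U1 E)). pose (E2 := cone (D U2 E)).
  assert (HE1 : regular E1) by (unfold E1; auto using regular_cone, regular_D).
  assert (HE2 : regular E2) by (unfold E2; auto using regular_cone, regular_D).
  assert (dE1 : dl E1 = D U1 E) by (apply dl_cone; rewrite dl_D, dE; now apply D_0).
  assert (dE2 : dl E2 = D U2 E) by (apply dl_cone; rewrite dl_D, dE; now apply D_0).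
  pose (E12 := fsub (D U1 E2) (D U2 E1)).
  assert (HE12 : regular E12) by (unfold E12; auto using regular_sub, regular_D).
  assert (dE12 : dl (cone E12) = E12).
  { apply dl_cone. unfold E12. rewrite dl_sub, !dl_D, dE1, dE2, (D_comm E HE).
    fn_ext. unfold fsub, f0. ring. }
  assert (HE1c : forall a, snd a = unitB -> E1 [] a = 0).
  { intros a Ha. unfold E1, cone, D, fsub, tr, E, cone. cbn [map].
    rewrite conj_central by assumption. rewrite mul_1_r, (proj1 (Hc1 a Ha)).
    rewrite (reg_n F HF [one; one]) by (simpl; auto). ring. }
  assert (HE2c : forall a, snd a = unitB -> E2 [] a = 0).
  { intros a Ha. unfold E2, cone, D, fsub, tr, E, cone. cbn [map].
    rewrite conj_central by assumption. rewrite mul_1_r, (proj2 (Hc1 a Ha)).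
    rewrite (reg_n F HF [one; one]) by (simpl; auto). ring. }
  destruct (koszul_top (cone E12)) as (Q & Q' & HQ & HQ' & EQ).
  { now apply regular_cone. }
  (* At the empty tuple [cone E12] is the difference of [F] on the two triangles of the unit square,
     up to degenerate terms. *)
  { intros a Ha. unfold cone at 1. unfold E12, D, fsub, tr, E1, E2, cone, D, fsub, tr, E, cone.
    cbn [map]. rewrite !conj_central by (rewrite ?conj_central; assumption). rewrite !mul_1_r, (Hc2 a Ha).
    rewrite (reg_n F HF [one; one; U1]), (reg_n F HF [one; one; U2]),
      (reg_n F HF [one; one; one]), (reg_n F HF [one; U1; U1]), (reg_n F HF [one; U2; U2])
      by (simpl; auto). ring. }
  (* The corrections by [dl Q'] and [dl Q] restore compatibility, because [dl (cone E12) = E12]. *)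
  destruct (koszul_middle (fsub E1 (dl Q')) (fsub E2 (dl Q))) as (W & HW & EW1 & EW2).
  { auto using regular_sub, regular_dl. }
  { auto using regular_sub, regular_dl. }
  { apply fsub_diag_eq. rewrite !D_sub, <- !dl_D.
    transitivity (fsub E12 (dl (cone E12))).
    - rewrite EQ, dl_sub. unfold E12. fn_ext. unfold fsub. ring.
    - rewrite dE12. fn_ext. unfold fsub, f0. ring. }
  { intros a Ha. unfold fsub. rewrite HE1c, HE2c by assumption. unfold dl; simpl. split; ring. }
  exists (fsub E (dl W)).
  split; [auto using regular_sub, regular_dl|].
  assert (H1 : D U1 (fsub E (dl W)) = f0).
  { rewrite D_sub, <- dl_D, <- EW1, dl_sub, dE1, dl_dl. fn_ext. unfold fsub, f0. ring. }
  assert (H2 : D U2 (fsub E (dl W)) = f0).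
  { rewrite D_sub, <- dl_D, <- EW2, dl_sub, dE2, dl_dl. fn_ext. unfold fsub, f0. ring. }
  split; [now apply fsub_diag_eq|]. split; [now apply fsub_diag_eq|].
  rewrite dl_sub, dE, dl_dl. apply fsub_0.
Qed.

(** Average the lattice-invariant primitive over [one] and [T]. Conjugation by [T] inverts [U1] and
    [U2], so the average stays lattice-invariant, and [U1], [U2], [T] generate [G] up to [z]. *)
Lemma exactness (F : fn) :
  regular F -> dl F = f0 -> (forall g, tr g F = F) ->
  (forall a, snd a = unitB -> F [one; U1] a = 0 /\ F [one; U2] a = 0) ->
  (forall a, snd a = unitB -> F [one; U2; mul U2 U1] a = F [one; U1; mul U1 U2] a) ->
  exists E, regular E /\ (forall g, tr g E = E) /\ dl E = F.
Proof.
  intros HF Hd Hinv Hc1 Hc2.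
  destruct (exact_lattice F) as (Z & HZ & Z1 & Z2 & dZ); auto.
  pose (h := Cinv (1 + 1)).
  pose (E := fscale h (fadd Z (tr T Z))).
  assert (HE : regular E).
  { apply (regular_weight (fun _ _ => h)), regular_add; auto using regular_tr. }
  assert (E1 : tr U1 E = E).
  { transitivity (fscale h (fadd (tr U1 Z) (tr U1 (tr T Z)))); [reflexivity|].
    rewrite Z1, <- tr_mul. replace (mul T U1) with (mul (inv U1) T) by reflexivity.
    now rewrite tr_mul, tr_inv. }
  assert (E2 : tr U2 E = E).
  { transitivity (fscale h (fadd (tr U2 Z) (tr U2 (tr T Z)))); [reflexivity|].
    rewrite Z2, <- tr_mul. replace (mul T U2) with (mul (inv U2) T) by reflexivity.
    now rewrite tr_mul, tr_inv. }
  assert (ET : tr T E = E).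
  { transitivity (fscale h (fadd (tr T Z) (tr T (tr T Z)))); [reflexivity|].
    rewrite <- tr_mul. change (mul T T) with one. rewrite tr_one. fn_ext.
    unfold E, fscale, fadd. ring. }
  exists E. split; [assumption|split].
  (* [v] runs through the powers of [u] modulo [z], negative ones included. *)
  - assert (Hpow : forall u, tr u E = E -> forall v, (forall k, snd (mul u (v k)) = snd (v (Z.succ k))) ->
      snd (v 0%Z) = snd one -> forall k, tr (v k) E = E).
    { intros u Hu v Hv H0 k. induction k as [|k IH|k IH] using Z.peano_ind.
      - rewrite (tr_snd _ one), tr_one; auto.
      - rewrite <- (tr_snd (mul u (v k))), tr_mul by auto. now rewrite Hu.
      - assert (Hk := Hv (Z.pred k)). rewrite Z.succ_pred in Hk.
        rewrite <- (tr_snd (mul (inv u) (v k))).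
        + rewrite tr_mul, tr_inv; auto.
        + assumption.
        + rewrite (mul_snd (inv u) (inv u) (v k) (mul u (v (Z.pred k)))) by auto.
          now rewrite mul_inv_l_assoc. }
    intros [k [[n m] e]].
    rewrite (tr_snd _ (mul (mul (emb (n, 0%Z, false)) (emb (0%Z, m, false))) (emb (0%Z, 0%Z, e)))).
    + rewrite !tr_mul. rewrite (Hpow U1 E1 (fun n => emb (n, 0%Z, false))).
      * rewrite (Hpow U2 E2 (fun m => emb (0%Z, m, false))).
        -- destruct e; [exact ET|]. apply tr_one.
        -- intros j. simpl. repeat f_equal; lia.
        -- reflexivity.
      * intros j. simpl. repeat f_equal; lia.
      * reflexivity.
    + assumption.
    + simpl. destruct e; simpl; repeat f_equal; lia.
  - unfold E. rewrite dl_scale.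
    assert (Hadd : dl (fadd Z (tr T Z)) = fadd F F).
    { transitivity (dl (fsub Z (fscale (Copp 1) (tr T Z)))).
      - f_equal. fn_ext. unfold fsub, fscale, fadd. ring.
      - rewrite dl_sub, dl_scale, dl_tr, dZ, Hinv. fn_ext. unfold fsub, fscale, fadd. ring. }
    rewrite Hadd. fn_ext. unfold fscale, fadd, h. field. apply C2_neq_0.
Qed.

End Theta.

(** * Hochschild cochains as homogeneous cochains *)

Lemma Csum_S_l (f : nat -> C) (n : nat) : Csum f (S n) = f 0%nat + Csum (fun i => f (S i)) n.
Proof. unfold Csum. simpl. now rewrite <- seq_shift, map_map. Qed.

Lemma Csum_S_r (f : nat -> C) (n : nat) : Csum f (S n) = Csum f n + f n.
Proof.
  revert f; induction n as [|n IH]; intros f.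
  - unfold Csum; simpl; ring.
  - rewrite Csum_S_l, IH, Csum_S_l. ring.
Qed.

Lemma Csum_ext (f g : nat -> C) (n : nat) :
  (forall i, (i < n)%nat -> f i = g i) -> Csum f n = Csum g n.
Proof.
  revert f g; induction n as [|n IH]; intros f g H; [reflexivity|].
  rewrite !Csum_S_r, H by lia. f_equal. apply IH. intros; apply H; lia.
Qed.

Lemma Csum_add (f g : nat -> C) (n : nat) :
  Csum (fun i => f i + g i) n = Csum f n + Csum g n.
Proof. induction n as [|n IH]; [unfold Csum; simpl; ring|]. rewrite !Csum_S_r, IH; ring. Qed.

Lemma Csum_scale (c : C) (f : nat -> C) (n : nat) : Csum (fun i => c * f i) n = c * Csum f n.
Proof. induction n as [|n IH]; [unfold Csum; simpl; ring|]. rewrite !Csum_S_r, IH; ring. Qed.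

Lemma Csum_0 (f : nat -> C) (n : nat) : (forall i, (i < n)%nat -> f i = 0) -> Csum f n = 0.
Proof.
  intros H. rewrite (Csum_ext f (fun _ => 0 * 0)), (Csum_scale 0 (fun _ => 0)); [ring|].
  intros; rewrite H; [ring|assumption].
Qed.

Definition faceG (i : nat) (L : list G) : list G :=
  firstn i L ++ mul (nth i L one) (nth (S i) L one) :: skipn (S (S i)) L.

(** The operator b' of cyclic cohomology, that is b without its last face; the recursion parallels
    that of [del]. *)
Fixpoint inner (f : list G -> C) (L : list G) : C :=
  match L with
  | g :: L' =>
      match L' with
      | h :: L'' => f (mul g h :: L'') - inner (fun Y => f (g :: Y)) L'
      | [] => 0
      end
  | [] => 0
  end.

Definition wrap (L : list G) : list G :=
  match L with
  | [] => []
  | g :: L' => mul (last L' one) g :: removelast L'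
  end.

Definition bG (f : list G -> C) (L : list G) : C :=
  inner f L + Csign (pred (length L)) * f (wrap L).

Lemma inner_Csum (f : list G -> C) (L : list G) :
  inner f L = Csum (fun i => Csign i * f (faceG i L)) (pred (length L)).
Proof.
  revert f; induction L as [|g [|h L] IH]; intros f; try reflexivity.
  cbn [length pred]. rewrite Csum_S_l.
  change (inner f (g :: h :: L)) with (f (mul g h :: L) - inner (fun Y => f (g :: Y)) (h :: L)).
  rewrite IH. cbn [length pred].
  transitivity (Csign 0 * f (faceG 0 (g :: h :: L)) +
    (Copp 1) * Csum (fun i => Csign i * f (g :: faceG i (h :: L))) (length L)).
  - unfold Csign, faceG; simpl. ring.
  - rewrite <- Csum_scale. f_equal. apply Csum_ext. intros i _.
    rewrite Csign_S. unfold faceG. simpl. ring.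
Qed.

Section Theta.
Variable theta : R.

Definition ksum (L : list G) : Z := fold_right (fun x s => (fst x + s)%Z) 0%Z L.

(* The multilinear extension of a cochain to monomials with a scalar factor. *)
Definition ext (phi : cochain) (L : list G) : C := lam_pow theta (ksum L) * phi (map snd L).

Lemma ksum_app (L M : list G) : ksum (L ++ M) = (ksum L + ksum M)%Z.
Proof. unfold ksum. induction L as [|x L IH]; simpl; [|rewrite IH]; lia. Qed.

Lemma ksum_emb (l : list Basis) : ksum (map emb l) = 0%Z.
Proof. unfold ksum. induction l as [|x l IH]; simpl; [|rewrite IH]; reflexivity. Qed.

Lemma map_snd_emb (l : list Basis) : map snd (map emb l) = l.
Proof. rewrite map_map. apply map_id. Qed.

Lemma ext_emb (phi : cochain) (l : list Basis) : ext phi (map emb l) = phi l.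
Proof. unfold ext. rewrite ksum_emb, map_snd_emb, lam_pow_0. ring. Qed.

Lemma hoch_b_emb (n : nat) (phi : cochain) (l : list Basis) :
  length l = S (S n) -> hoch_b theta n phi l = bG (ext phi) (map emb l).
Proof.
  intros Hl. unfold hoch_b, bG. rewrite inner_Csum, length_map, Hl. cbn [pred]. f_equal.
  - apply Csum_ext. intros i Hi. unfold face. rewrite mulB_mul. f_equal.
    unfold ext, faceG.
    assert (Hnth : forall j, nth j (map emb l) one = emb (nth j l unitB)).
    { intros j. apply (map_nth emb). }
    rewrite !Hnth. rewrite ksum_app. rewrite firstn_map, skipn_map.
    cbn [ksum fold_right]. fold (ksum (map emb (skipn (S (S i)) l))). rewrite !ksum_emb.
    rewrite map_app. cbn [map]. rewrite !map_snd_emb. f_equal; f_equal; lia.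
  - destruct l as [|g l]; [easy|]. unfold last_face. rewrite mulB_mul. f_equal.
    unfold ext, wrap. cbn [map].
    assert (Hlast : forall l, last (map emb l) one = emb (last l unitB)).
    { clear. induction l as [|x [|y l] IH]; auto. }
    assert (Hrem : forall l, removelast (map emb l) = map emb (removelast l)).
    { clear. induction l as [|x [|y l] IH]; auto.
      change (emb x :: removelast (map emb (y :: l)) = emb x :: map emb (removelast (y :: l))).
      now rewrite IH. }
    rewrite Hlast, Hrem. cbn [ksum fold_right map]. fold (ksum (map emb (removelast l))).
    rewrite ksum_emb, map_snd_emb. f_equal; f_equal; lia.
Qed.

(* [f] and [f'] are the same homogeneous function up to the scalar [lambda^c]. *)
Definition twisted (c : Z) (f f' : list G -> C) : Prop :=
  forall L L' : list G, map snd L = map snd L' -> f L = lam_pow theta (c + ksum L - ksum L') * f' L'.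

(** The exponent [c] is arbitrary because the recursion passes the power of [z] of the first entry
    on to the function of the remaining ones. *)
Lemma inner_twisted (c : Z) (f f' : list G -> C) :
  twisted c f f' -> twisted c (inner f) (inner f').
Proof.
  intros H L; revert c f f' H; induction L as [|g [|h L] IH]; intros c f f' H [|g' [|h' L']];
    try easy; intros E; try (simpl; ring).
  injection E as E1 E2 E3.
  change (inner f (g :: h :: L)) with (f (mul g h :: L) - inner (fun Y => f (g :: Y)) (h :: L)).
  change (inner f' (g' :: h' :: L'))
    with (f' (mul g' h' :: L') - inner (fun Y => f' (g' :: Y)) (h' :: L')).
  rewrite (IH (c + fst g - fst g')%Z _ (fun Y => f' (g' :: Y))) with (L' := h' :: L').
  - rewrite (H _ (mul g' h' :: L')) by (simpl; f_equal; auto using mul_snd).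
    assert (K : fst (mul g h) = (fst (mul g' h') + fst g - fst g' + fst h - fst h')%Z).
    { rewrite (zpow_eq g g') at 1 by assumption. rewrite (zpow_eq h h') at 1 by assumption.
      rewrite zpow_mul_l, zpow_mul_r. unfold zpow. cbn [fst]. ring. }
    cbn [ksum fold_right]. fold (ksum L) (ksum L'). rewrite K.
    replace (c + (fst (mul g' h') + fst g - fst g' + fst h - fst h' + ksum L) -
      (fst (mul g' h') + ksum L'))%Z
      with (c + fst g - fst g' + (fst h + ksum L) - (fst h' + ksum L'))%Z by ring.
    replace (c + (fst g + (fst h + ksum L)) - (fst g' + (fst h' + ksum L')))%Z
      with (c + fst g - fst g' + (fst h + ksum L) - (fst h' + ksum L'))%Z by ring.
    ring.
  - intros Y Y' EY. rewrite (H (g :: Y) (g' :: Y')) by (simpl; congruence).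
    f_equal. f_equal. simpl. lia.
  - simpl; congruence.
Qed.

Lemma ext_twisted (phi : cochain) : twisted 0 (ext phi) (ext phi).
Proof.
  intros L L' E. unfold ext. rewrite E.
  transitivity (lam_pow theta (0 + ksum L - ksum L' + ksum L') * phi (map snd L')).
  - f_equal. f_equal. lia.
  - rewrite lam_pow_add. ring.
Qed.

Lemma last_cons {X} (x y : X) (l : list X) : last (y :: l) x = last l y.
Proof.
  revert x y; induction l as [|z l IH]; intros x y; [reflexivity|].
  change (last (z :: l) x = last (z :: l) y). now rewrite !IH.
Qed.

Lemma removelast_last_snd (L L' : list G) :
  map snd L = map snd L' ->
  map snd (removelast L) = map snd (removelast L') /\ snd (last L one) = snd (last L' one) /\
  (ksum L - ksum L' = ksum (removelast L) - ksum (removelast L') +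
     fst (last L one) - fst (last L' one))%Z.
Proof.
  revert L'; induction L as [|x L IH]; intros [|x' L']; try easy.
  intros E; injection E as E1 E2. destruct (IH L' E2) as (I1 & I2 & I3).
  destruct L as [|y L], L' as [|y' L']; try easy.
  - simpl. repeat split; auto. lia.
  - change (removelast (x :: y :: L)) with (x :: removelast (y :: L)).
    change (removelast (x' :: y' :: L')) with (x' :: removelast (y' :: L')).
    change (last (x :: y :: L) one) with (last (y :: L) one).
    change (last (x' :: y' :: L') one) with (last (y' :: L') one).
    repeat split; [simpl map in *; congruence|assumption|].
    cbn [ksum fold_right] in *.
    fold (ksum (removelast (y :: L))) (ksum (removelast (y' :: L'))) in *. lia.
Qed.

Lemma bG_twisted (f : list G -> C) : twisted 0 f f -> twisted 0 (bG f) (bG f).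
Proof.
  intros H L L' E. unfold bG. rewrite (inner_twisted 0 f f H L L' E).
  assert (El : length L = length L').
  { apply (f_equal (@length _)) in E. now rewrite !length_map in E. }
  rewrite (H (wrap L) (wrap L')).
  - rewrite El.
    replace (0 + ksum (wrap L) - ksum (wrap L'))%Z with (0 + ksum L - ksum L')%Z; [ring|].
    destruct L as [|g L], L' as [|g' L']; try easy.
    injection E as E1 E2. destruct (removelast_last_snd L L' E2) as (I1 & I2 & I3).
    unfold wrap. cbn [ksum fold_right].
    fold (ksum L) (ksum L') (ksum (removelast L)) (ksum (removelast L')).
    rewrite (zpow_eq g g') at 2 by assumption.
    rewrite (zpow_eq (last L one) (last L' one)) by assumption.
    rewrite zpow_mul_l, zpow_mul_r. unfold zpow; cbn [fst]. lia.
  - destruct L as [|g L], L' as [|g' L']; try easy.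
    injection E as E1 E2. destruct (removelast_last_snd L L' E2) as (I1 & I2 & I3).
    unfold wrap. cbn [map]. f_equal; auto using mul_snd.
Qed.

Lemma twisted_emb (f : list G -> C) (L : list G) :
  twisted 0 f f -> f L = lam_pow theta (ksum L) * f (map emb (map snd L)).
Proof.
  intros H. rewrite (H L (map emb (map snd L))) by now rewrite map_snd_emb.
  rewrite ksum_emb. f_equal. f_equal. lia.
Qed.

(** Both sides are homogeneous in [z], so it is enough to compare them on monomials without
    scalar. *)
Lemma ext_hoch_b (n : nat) (phi : cochain) (L : list G) :
  length L = S (S n) -> ext (hoch_b theta n phi) L = bG (ext phi) L.
Proof.
  intros HL. rewrite (twisted_emb (bG (ext phi))) by auto using bG_twisted, ext_twisted.
  unfold ext at 1. rewrite hoch_b_emb by now rewrite length_map. reflexivity.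
Qed.

(** * Homogeneous and inhomogeneous cochains *)

Fixpoint diffs (x : G) (l : list G) : list G :=
  match l with
  | [] => []
  | y :: l' => mul (inv x) y :: diffs y l'
  end.

Fixpoint prods (x : G) (r : list G) : list G :=
  match r with
  | [] => []
  | g :: r' => mul x g :: prods (mul x g) r'
  end.

(* [hom] and [inh] exchange Hochschild and homogeneous cochains:
   [F (x0, .., xn; a) = f (xn^-1 a x0, x0^-1 x1, .., x(n-1)^-1 xn)]. *)
Definition hom (f : list G -> C) : fn := fun X a =>
  match X with
  | [] => 0
  | x :: l => f (mul (mul (inv (last l x)) a) x :: diffs x l)
  end.

Definition inh (E : fn) (L : list G) : C :=
  match L with
  | [] => 0
  | g :: r => E (one :: prods one r) (mul (last (prods one r) one) g)
  end.

Lemma length_diffs (x : G) (l : list G) : length (diffs x l) = length l.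
Proof. revert x; induction l as [|y l IH]; intros x; simpl; auto. Qed.
Lemma length_prods (x : G) (l : list G) : length (prods x l) = length l.
Proof. revert x; induction l as [|y l IH]; intros x; simpl; auto. Qed.

(** The last vertex is a separate argument because it also enters the first slot of [hom]; only its
    own omission changes it, whence the extra term. *)
Lemma del_last (x : G) (l : list G) (f : list G -> G -> C) :
  l <> [] ->
  del (fun y => f (diffs x y) (last y x)) l =
  inner (fun d => f d (last l x)) (diffs x l) -
  Csign (length l) * f (diffs x (removelast l)) (last (removelast l) x).
Proof.
  revert x f; induction l as [|y [|z l] IH]; intros x f Hl; [easy| |].
  - simpl. unfold Csign; simpl. ring.
  - change (del (fun y => f (diffs x y) (last y x)) (y :: z :: l))
      with (f (diffs x (z :: l)) (last (z :: l) x) -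
            del (fun w => f (diffs x (y :: w)) (last (y :: w) x)) (z :: l)).
    rewrite (del_ext _ (fun w => f (mul (inv x) y :: diffs y w) (last w y))).
    2:{ intros w. now rewrite last_cons. }
    rewrite (IH y (fun d v => f (mul (inv x) y :: d) v)) by easy.
    change (removelast (y :: z :: l)) with (y :: removelast (z :: l)).
    rewrite (last_cons x y (removelast (z :: l))), (last_cons x y (z :: l)).
    change (inner (fun d => f d (last (z :: l) y)) (diffs x (y :: z :: l))) with
      (f (mul (mul (inv x) y) (mul (inv y) z) :: diffs z l) (last (z :: l) y) -
       inner (fun d => f (mul (inv x) y :: d) (last (z :: l) y)) (diffs y (z :: l))).
    rewrite <- (mul_assoc (inv x) y), mul_inv_r_assoc.
    change (length (y :: z :: l)) with (S (length (z :: l))). rewrite Csign_S.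
    change (diffs x (z :: l)) with (mul (inv x) z :: diffs z l).
    change (diffs x (y :: removelast (z :: l)))
      with (mul (inv x) y :: diffs y (removelast (z :: l))).
    rewrite !last_cons. ring.
Qed.

Lemma diffs_removelast (x : G) (l : list G) :
  removelast (diffs x l) = diffs x (removelast l).
Proof.
  revert x; induction l as [|y [|z l] IH]; intros x; auto.
  change (mul (inv x) y :: removelast (diffs y (z :: l)) =
    mul (inv x) y :: diffs y (removelast (z :: l))). now rewrite IH.
Qed.

Lemma diffs_last (x : G) (l : list G) :
  l <> [] -> last (diffs x l) one = mul (inv (last (removelast l) x)) (last l x).
Proof.
  revert x; induction l as [|y [|z l] IH]; intros x H; [easy|reflexivity|].
  change (last (diffs x (y :: z :: l)) one) with (last (diffs y (z :: l)) one).
  rewrite IH by easy. change (removelast (y :: z :: l)) with (y :: removelast (z :: l)).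
  now rewrite !last_cons.
Qed.

(** Omitting the first vertex multiplies the first two slots, omitting the last one multiplies the
    last slot into the first, any other omission merges two neighbours. On a single vertex the sides
    can differ, since [hom] is zero on the empty tuple. *)
Lemma dl_hom (f : list G -> C) (X : list G) (a : G) :
  (2 <= length X)%nat -> dl (hom f) X a = hom (bG f) X a.
Proof.
  destruct X as [|x [|y l]]; cbn [length]; try lia. intros _.
  unfold dl. change (del (fun Y => hom f Y a) (x :: y :: l)) with
    (hom f (y :: l) a - del (fun w => hom f (x :: w) a) (y :: l)).
  unfold hom at 2.
  rewrite (del_last x (y :: l) (fun d z => f (mul (mul (inv z) a) x :: d))) by easy.
  unfold hom. rewrite last_cons. unfold bG, wrap.
  change (inner f (mul (mul (inv (last l y)) a) x :: diffs x (y :: l))) with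
    (f (mul (mul (mul (inv (last l y)) a) x) (mul (inv x) y) :: diffs y l) -
     inner (fun d => f (mul (mul (inv (last l y)) a) x :: d)) (diffs x (y :: l))).
  rewrite <- (mul_assoc _ x), mul_inv_r_assoc.
  rewrite diffs_removelast, diffs_last, last_cons by easy.
  cbn [length pred]. rewrite length_diffs.
  assert (Hm : forall z w, mul (mul (inv z) w) (mul (mul (inv w) a) x) = mul (mul (inv z) a) x).
  { intros z w. now rewrite <- !mul_assoc, mul_inv_r_assoc. }
  rewrite Hm. cbn [length]. ring.
Qed.

Lemma diffs_map (g x : G) (l : list G) : diffs (mul g x) (map (mul g) l) = diffs x l.
Proof.
  revert x; induction l as [|y l IH]; intros x; simpl; [reflexivity|].
  rewrite IH. f_equal. now rewrite inv_mul, <- mul_assoc, mul_inv_l_assoc.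
Qed.

Lemma last_map {X Y} (h : X -> Y) (x : X) (l : list X) : last (map h l) (h x) = h (last l x).
Proof. revert x; induction l as [|y l IH]; intros x; [reflexivity|].
  simpl map. now rewrite !last_cons. Qed.

Lemma hom_invariant (f : list G -> C) (g : G) : tr g (hom f) = hom f.
Proof.
  fn_ext. unfold tr, hom. destruct X as [|x l]; [reflexivity|]. cbn [map].
  rewrite diffs_map, last_map. f_equal. f_equal. unfold conj.
  rewrite inv_mul, <- !mul_assoc. now rewrite !mul_inv_l_assoc.
Qed.

Lemma diffs_snd (x x' : G) (l l' : list G) :
  snd x = snd x' -> map snd l = map snd l' ->
  map snd (diffs x l) = map snd (diffs x' l') /\ snd (last l x) = snd (last l' x') /\
  (ksum (diffs x l) - ksum (diffs x' l') =
    fst (last l x) - fst (last l' x') - (fst x - fst x'))%Z.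
Proof.
  revert x x' l'; induction l as [|y l IH]; intros x x' [|y' l'] Hx E; try easy.
  - simpl. repeat split; auto. lia.
  - injection E as E1 E2. rewrite !last_cons. destruct (IH y y' l' E1 E2) as (I1 & I2 & I3).
    simpl map. simpl ksum. fold (ksum (diffs y l)) (ksum (diffs y' l')).
    repeat split; auto.
    + f_equal; auto using mul_snd, inv_snd.
    + assert (K : fst (mul (inv x) y) =
        (fst (mul (inv x') y') - (fst x - fst x') + (fst y - fst y'))%Z).
      { rewrite (zpow_eq x x') at 1 by assumption. rewrite (zpow_eq y y') at 1 by assumption.
        rewrite inv_zpow, zpow_mul_l, zpow_mul_r. unfold zpow; cbn [fst]. ring. }
      rewrite K. lia.
Qed.

Definition normal (f : list G -> C) : Prop :=
  forall L, In unitB (map snd (tl L)) -> f L = 0.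

Lemma degen_diffs (x : G) (l : list G) :
  degen (x :: l) <-> In unitB (map snd (diffs x l)).
Proof.
  revert x; induction l as [|y l IH]; intros x; [simpl; tauto|].
  change (snd x = snd y \/ degen (y :: l) <->
    snd (mul (inv x) y) = unitB \/ In unitB (map snd (diffs y l))).
  rewrite (IH y). assert (snd x = snd y <-> snd (mul (inv x) y) = unitB); [|tauto].
  split; intros H.
  - rewrite (mul_snd _ _ _ x eq_refl (eq_sym H)), mul_inv_l. reflexivity.
  - assert (E : snd (mul x (mul (inv x) y)) = snd (mul x one)) by (now apply mul_snd).
    rewrite mul_inv_r_assoc, mul_1_r in E. auto.
Qed.

Lemma hom_regular (f : list G -> C) : twisted 0 f f -> normal f -> regular theta (hom f).
Proof.
  intros Hf Hn; split; unfold hom.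
  - intros [|x l] [|x' l'] a k E; try easy; [ring|].
    injection E as E1 E2. destruct (diffs_snd x x' l l' E1 E2) as (I1 & I2 & I3).
    rewrite (Hf _ (mul (mul (inv (last l' x')) a) x' :: diffs x' l')).
    + f_equal. f_equal. simpl ksum. fold (ksum (diffs x l)) (ksum (diffs x' l')).
      assert (K : fst (mul (mul (inv (last l x)) (zpow k a)) x) =
        (fst (mul (mul (inv (last l' x')) a) x') + k - (fst (last l x) - fst (last l' x'))
         + (fst x - fst x'))%Z).
      { rewrite (zpow_eq x x') at 2 by assumption.
        rewrite (zpow_eq (last l x) (last l' x')) at 1 by assumption.
        rewrite inv_zpow, !zpow_mul_l, !zpow_mul_r, !zpow_mul_l. unfold zpow; cbn [fst]. ring. }
      rewrite K. lia.
    + simpl map. f_equal; [|assumption].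
      apply mul_snd; [apply mul_snd|]; auto using inv_snd.
  - intros [|x l] a Hd; [easy|]. apply Hn. simpl. now apply degen_diffs.
Qed.

Lemma prods_diffs (g x : G) (l : list G) : prods (mul g x) (diffs x l) = map (mul g) l.
Proof.
  revert x; induction l as [|y l IH]; intros x; simpl; [reflexivity|].
  now rewrite <- mul_assoc, mul_inv_r_assoc, IH.
Qed.

Lemma diffs_prods (x : G) (l : list G) : diffs x (prods x l) = l.
Proof.
  revert x; induction l as [|y l IH]; intros x; simpl; [reflexivity|].
  now rewrite mul_inv_l_assoc, IH.
Qed.

(** Invariance moves the first vertex to [one], where [inh] evaluates. *)
Lemma hom_inh (E : fn) (X : list G) (a : G) :
  (forall g, tr g E = E) -> X <> [] -> hom (inh E) X a = E X a.
Proof.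
  intros HE HX. destruct X as [|x l]; [easy|]. unfold hom, inh.
  rewrite <- (mul_inv_l x), prods_diffs, last_map.
  rewrite <- mul_assoc, (mul_assoc (last l x)), (mul_assoc (last l x)), mul_inv_r, mul_1_l.
  rewrite mul_assoc. transitivity (tr (inv x) E (x :: l) a); [|now rewrite HE].
  unfold tr, conj. now rewrite inv_inv.
Qed.

Lemma hom_prods (f : list G -> C) (g : G) (r : list G) :
  hom f (one :: prods one r) (mul (last (prods one r) one) g) = f (g :: r).
Proof. unfold hom. now rewrite diffs_prods, mul_inv_l_assoc, mul_1_r. Qed.

Lemma prods_snd (x x' : G) (l l' : list G) :
  snd x = snd x' -> map snd l = map snd l' ->
  map snd (prods x l) = map snd (prods x' l') /\
  last (prods x l) x = zpow (fst x - fst x' + ksum l - ksum l') (last (prods x' l') x').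
Proof.
  revert x x' l'; induction l as [|y l IH]; intros x x' [|y' l'] Hx E; try easy.
  - split; [reflexivity|]. simpl. rewrite (zpow_eq x x') at 1 by assumption.
    f_equal. simpl. lia.
  - injection E as E1 E2. simpl prods. rewrite !last_cons.
    destruct (IH (mul x y) (mul x' y') l' (mul_snd _ _ _ _ Hx E1) E2) as (I1 & I2).
    split.
    + simpl. f_equal; auto using mul_snd.
    + rewrite I2. f_equal.
      rewrite (zpow_eq x x') at 1 by assumption. rewrite (zpow_eq y y') at 1 by assumption.
      rewrite zpow_mul_l, zpow_mul_r. unfold zpow; cbn [fst]. simpl ksum.
      fold (ksum l) (ksum l'). lia.
Qed.

Lemma inh_twisted (E : fn) : regular theta E -> twisted 0 (inh E) (inh E).
Proof.
  intros HE [|g r] [|g' r'] EL; try easy; [simpl; ring|].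
  injection EL as E1 E2. unfold inh.
  destruct (prods_snd one one r r' eq_refl E2) as (I1 & I2).
  rewrite I2. rewrite (zpow_eq g g') at 1 by assumption. rewrite zpow_mul_l, zpow_mul_r.
  rewrite !(reg_z theta E HE _ (one :: prods one r')) by (simpl; congruence).
  simpl ksum. fold (ksum r) (ksum r').
  replace (0 + (fst g + ksum r) - (fst g' + ksum r'))%Z
    with ((fst one - fst one + ksum r - ksum r') + (fst g - fst g'))%Z by lia.
  rewrite lam_pow_add. ring.
Qed.

Lemma inh_normal (E : fn) : regular theta E -> normal (inh E).
Proof.
  intros HE [|g r] H; [reflexivity|]. unfold inh. apply (reg_n theta E HE).
  apply degen_diffs. now rewrite diffs_prods.
Qed.

Definition norm_at (n : nat) (phi : cochain) : Prop :=
  forall l, length l = S n -> In unitB (tl l) -> phi l = 0.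

(** A cocycle is closed in one degree and arbitrary on other lengths, whereas [fn] holds all lengths
    at once; with zeros elsewhere the homogeneous form is closed everywhere. *)
Definition trunc (n : nat) (phi : cochain) : cochain :=
  fun l => if Nat.eqb (length l) n then phi l else 0.

Lemma trunc_eq (n : nat) (phi : cochain) (l : list Basis) :
  length l = n -> trunc n phi l = phi l.
Proof. intros <-. unfold trunc. now rewrite Nat.eqb_refl. Qed.

Lemma map_tl {X Y} (f : X -> Y) (l : list X) : map f (tl l) = tl (map f l).
Proof. now destruct l. Qed.

Lemma ext_trunc_normal (n : nat) (phi : cochain) :
  norm_at n phi -> normal (ext (trunc (S n) phi)).
Proof.
  intros H L HL. unfold ext, trunc. rewrite length_map.
  destruct (Nat.eqb_spec (length L) (S n)) as [E|E]; [|ring].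
  rewrite H; [ring|now rewrite length_map|]. now rewrite <- map_tl.
Qed.

Lemma ext_trunc_0 (n : nat) (phi : cochain) (L : list G) :
  length L <> n -> ext (trunc n phi) L = 0.
Proof.
  intros H. unfold ext, trunc.
  destruct (Nat.eqb_spec (length (map snd L)) n) as [E|E]; [|ring].
  now rewrite length_map in E.
Qed.

Lemma hoch_b_ext (n : nat) (phi psi : cochain) (l : list Basis) :
  length l = S (S n) -> (forall l, length l = S n -> phi l = psi l) ->
  hoch_b theta n phi l = hoch_b theta n psi l.
Proof.
  intros Hl H. unfold hoch_b. f_equal.
  - apply Csum_ext. intros i Hi. unfold face. rewrite mulB_mul. rewrite H; [reflexivity|].
    rewrite length_app, length_firstn. cbn [length]. rewrite length_skipn. lia.
  - destruct l as [|g l]; [easy|]. unfold last_face. rewrite mulB_mul. rewrite H; [reflexivity|].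
    cbn [length] in *. destruct (exists_last (l := l)) as (l' & z & ->).
    { intros ->; easy. }
    rewrite removelast_last. rewrite length_app in Hl. simpl in Hl. lia.
Qed.

Lemma del_length {X} (f g : list X -> C) (l : list X) :
  (forall y, length y = pred (length l) -> f y = g y) -> del f l = del g l.
Proof.
  revert f g; induction l as [|x l IH]; intros f g H; [reflexivity|]. simpl.
  rewrite (H l) by reflexivity. f_equal. destruct l as [|y l]; [reflexivity|].
  apply IH. intros w Hw. apply H. simpl in *. lia.
Qed.

Lemma length_hom_arg (f : list G -> C) (n : nat) (X : list G) (a : G) :
  (forall L, length L = n -> f L = 0) -> length X = n -> hom f X a = 0.
Proof.
  intros H <-. destruct X as [|x l]; [reflexivity|]. apply H. cbn [length].
  now rewrite length_diffs.
Qed.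

Lemma dl_hom_cocycle (n : nat) (phi : cochain) :
  (forall l, length l = S (S n) -> hoch_b theta n phi l = 0) ->
  dl (hom (ext (trunc (S n) phi))) = f0.
Proof.
  intros H. fn_ext. destruct (Nat.eq_dec (length X) (S (S n))) as [E|E].
  - rewrite dl_hom by lia. unfold f0. apply (length_hom_arg _ (S (S n))); [|assumption].
    intros L HL. rewrite <- ext_hoch_b with (n := n) by assumption.
    unfold ext. rewrite (hoch_b_ext n _ phi), H; [ring|now rewrite length_map..|].
    intros; now apply trunc_eq.
  - unfold dl, f0. destruct X as [|x l]; [reflexivity|].
    rewrite (del_length _ (fun _ => 0)); [apply del_0|].
    intros Y HY. apply (length_hom_arg _ (length Y)); [|reflexivity].
    intros L HL. apply ext_trunc_0. simpl in *. lia.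
Qed.

Definition cob (E : fn) : cochain := fun l => inh E (map emb l).

Lemma ext_cob (E : fn) (L : list G) : regular theta E -> ext (cob E) L = inh E L.
Proof.
  intros HE. rewrite (twisted_emb (inh E)) by now apply inh_twisted. reflexivity.
Qed.

Lemma cob_norm_at (E : fn) (n : nat) : regular theta E -> norm_at n (cob E).
Proof.
  intros HE l _ H. apply (inh_normal E HE). now rewrite map_tl, map_snd_emb.
Qed.

Lemma hoch_b_cob (E : fn) (n : nat) (g : Basis) (r : list Basis) :
  regular theta E -> (forall g, tr g E = E) -> length r = S n ->
  hoch_b theta n (cob E) (g :: r) =
  dl E (one :: prods one (map emb r)) (mul (last (prods one (map emb r)) one) (emb g)).
Proof.
  intros HE Hinv Hr. rewrite hoch_b_emb by (cbn [length]; lia).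
  replace (ext (cob E)) with (inh E)
    by (apply functional_extensionality; intros; symmetry; now apply ext_cob).
  cbn [map]. rewrite <- hom_prods, <- dl_hom
    by (cbn [length]; rewrite length_prods, length_map; lia).
  unfold dl. apply del_length. intros Y HY. apply hom_inh; [assumption|].
  intros ->. cbn [length pred] in HY. rewrite length_prods, length_map in HY. lia.
Qed.

(** * Hochschild cohomology in positive degrees *)

Hypothesis Hirr : irrational theta.

(* The value on the fundamental cycle of the torus. *)
Definition fund (f : list G -> C) : C :=
  hom f [one; U2; mul U2 U1] one - hom f [one; U1; mul U1 U2] one.

(** [phi] has degree [S n], so the premise on [fund] concerns degree 2. *)
Lemma hochschild_exact (n : nat) (phi : cochain) :
  norm_at (S n) phi -> (forall l, length l = S (S (S n)) -> hoch_b theta (S n) phi l = 0) ->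
  (n = 1%nat -> fund (ext phi) = 0) ->
  exists h, norm_at n h /\ forall l, length l = S (S n) -> hoch_b theta n h l = phi l.
Proof.
  intros Hn Hb Hf.
  pose (F := hom (ext (trunc (S (S n)) phi))).
  assert (HF : regular theta F).
  { apply hom_regular; [apply ext_twisted|now apply ext_trunc_normal]. }
  assert (HdF : dl F = f0) by now apply dl_hom_cocycle.
  assert (Hinv : forall g, tr g F = F) by apply hom_invariant.
  assert (H0 : forall X a, length X <> S (S n) -> F X a = 0).
  { intros X a HX. apply (length_hom_arg _ (length X)); [|reflexivity].
    intros L HL. apply ext_trunc_0. lia. }
  destruct (exactness theta Hirr F) as (E & HE & Einv & HdE); auto.
  (* In degree 1 and at central [a], [F [one; U] a] is additive in [U]: a homomorphism from [G] to
     the complex numbers. Conjugation by [T] inverts [U], so the value equals its own negative. *)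
  - intros a Ha. assert (Hc : forall U, mul T U = mul (inv U) T -> F [one; U] a = 0).
    { intros U HU. destruct n as [|n]; [clearbody F|apply H0; simpl; lia].
      assert (Hg : forall g x y, F [mul g x; mul g y] a = F [x; y] a).
      { intros g x y. assert (e := equal_f (equal_f (Hinv g) [x; y]) a).
        unfold tr in e. rewrite conj_central in e by assumption. exact e. }
      assert (Hd : forall x y z, F [y; z] a - (F [x; z] a - F [x; y] a) = 0).
      { intros x y z. assert (e := equal_f (equal_f HdF [x; y; z]) a).
        unfold dl, f0 in e. simpl in e. rewrite <- e. ring. }
      assert (Hxx : forall x, F [x; x] a = 0).
      { intros x. apply (reg_n theta F HF). simpl; auto. }
      assert (Hop : forall x y, F [y; x] a = - F [x; y] a).
      { intros x y. assert (e := Hd x y x). rewrite Hxx in e.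
        apply Csub_diag_eq in e. rewrite e. ring. }
      assert (Hadd : forall x y z, F [x; z] a = F [x; y] a + F [y; z] a).
      { intros x y z. apply Csub_diag_eq. transitivity (- (F [y; z] a - (F [x; z] a - F [x; y] a))).
        - ring.
        - rewrite Hd. ring. }
      apply (Cmul_neq_0 (1 + 1)); [apply C2_neq_0|].
      transitivity (F [one; U] a + F [mul T one; mul T U] a); [rewrite Hg; ring|].
      rewrite HU, mul_1_r, (Hadd T one), (Hadd one (inv U) (mul (inv U) T)).
      assert (e1 : F [inv U; mul (inv U) T] a = F [one; T] a).
      { rewrite <- (Hg (inv U) one T), mul_1_r. reflexivity. }
      assert (e2 : F [one; inv U] a = - F [one; U] a).
      { rewrite <- (Hg U one (inv U)), mul_1_r, mul_inv_r. apply Hop. }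
      rewrite e1, e2, (Hop T one). ring. }
    split; apply Hc; reflexivity.
  (* In degree 2 this is the vanishing of [fund]; in all others the tuples have the wrong length. *)
  - intros a Ha. destruct (Nat.eq_dec n 1) as [->|Hn1].
    2:{ rewrite !H0 by (simpl; lia). reflexivity. }
    rewrite (central_eq a Ha). rewrite !(reg_z theta F HF _ _ one _ eq_refl). f_equal.
    assert (e := Csub_diag_eq _ _ (Hf eq_refl)).
    exact e.
  - exists (cob E). split; [now apply cob_norm_at|].
    intros [|g r] Hl; [easy|]. injection Hl as Hl.
    rewrite hoch_b_cob, HdE by assumption. unfold F. rewrite hom_prods.
    change (emb g :: map emb r) with (map emb (g :: r)). rewrite ext_emb.
    apply trunc_eq. simpl; lia.
Qed.

End Theta.

(** * Connes' operator [B] *)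

Lemma Csum_split (f : nat -> C) (m n : nat) :
  Csum f (m + n) = Csum f m + Csum (fun i => f (m + i)%nat) n.
Proof.
  induction n as [|n IH].
  - rewrite Nat.add_0_r. unfold Csum at 3; simpl. ring.
  - rewrite Nat.add_succ_r, !Csum_S_r, IH. ring.
Qed.

Lemma Csum_telescope (f : nat -> C) (n : nat) :
  Csum (fun i => f i - f (S i)) n = f 0%nat - f n.
Proof.
  induction n as [|n IH]; [unfold Csum; simpl; ring|]. rewrite Csum_S_r, IH. ring.
Qed.

Lemma Csign_parity (a b c d : nat) : (a + 2 * c = b + 2 * d)%nat -> Csign a = Csign b.
Proof.
  intros H. transitivity (Csign (a + 2 * c)).
  - rewrite Csign_add, Csign_double. ring.
  - rewrite H, Csign_add, Csign_double. ring.
Qed.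

Definition rotl {X} (l : list X) : list X := match l with [] => [] | x :: l' => l' ++ [x] end.
Definition rot {X} (k : nat) (l : list X) : list X := Nat.iter k rotl l.

Lemma rot_app {X} (u v : list X) : rot (length u) (u ++ v) = v ++ u.
Proof.
  revert v; induction u as [|x u IH]; intros v.
  - simpl. now rewrite app_nil_r.
  - unfold rot in *. cbn [length]. rewrite Nat.iter_succ_r. cbn [app rotl].
    now rewrite <- app_assoc, IH, <- app_assoc.
Qed.

Lemma rot_skipn {X} (k : nat) (l : list X) : (k <= length l)%nat -> skipn k l ++ firstn k l = rot k l.
Proof.
  intros H. rewrite <- rot_app, firstn_skipn. now rewrite length_firstn, Nat.min_l.
Qed.

Lemma rot_length_self {X} (l : list X) : rot (length l) l = l.
Proof. rewrite <- (app_nil_r l) at 2. now rewrite rot_app. Qed.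

Lemma length_rot {X} (k : nat) (l : list X) : length (rot k l) = length l.
Proof.
  induction k as [|k IH]; [reflexivity|]. rewrite <- IH.
  change (length (rotl (rot k l)) = length (rot k l)). destruct (rot k l) as [|x m]; [reflexivity|].
  simpl. rewrite length_app. simpl. lia.
Qed.

Lemma map_rot {X Y} (f : X -> Y) (k : nat) (l : list X) : map f (rot k l) = rot k (map f l).
Proof.
  induction k as [|k IH]; [reflexivity|].
  change (map f (rotl (rot k l)) = rotl (rot k (map f l))). rewrite <- IH.
  destruct (rot k l); [reflexivity|]. simpl. now rewrite map_app.
Qed.

Lemma In_rot {X} (x : X) (k : nat) (l : list X) : In x (rot k l) <-> In x l.
Proof.
  induction k as [|k IH]; [reflexivity|]. rewrite <- IH.
  change (In x (rotl (rot k l)) <-> In x (rot k l)). destruct (rot k l); [reflexivity|].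
  simpl. rewrite in_app_iff. simpl. tauto.
Qed.

(** All faces under one index, [wrap] being the last, so that [cface_rotl] and [cface_last_rotl] are
    the relations of a cyclic module. *)
Definition cface (i : nat) (L : list G) : list G :=
  if (i <? pred (length L))%nat then faceG i L else wrap L.

Lemma bG_cface (f : list G -> C) (L : list G) (m : nat) : length L = S m ->
  bG f L = Csum (fun i => Csign i * f (cface i L)) (S m).
Proof.
  intros H. unfold bG. rewrite inner_Csum, Csum_S_r. unfold cface. rewrite H. cbn [pred].
  rewrite Nat.ltb_irrefl. f_equal. apply Csum_ext. intros i Hi.
  now rewrite (proj2 (Nat.ltb_lt _ _) Hi).
Qed.

Lemma inner_cface (f : list G -> C) (L : list G) (m : nat) : length L = S m ->
  inner f L = Csum (fun i => Csign i * f (cface i L)) m.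
Proof.
  intros H. rewrite inner_Csum. unfold cface. rewrite H. cbn [pred].
  apply Csum_ext. intros i Hi. now rewrite (proj2 (Nat.ltb_lt _ _) Hi).
Qed.

Lemma faceG_app (i : nat) (L : list G) (x : G) :
  (S i < length L)%nat -> faceG i (L ++ [x]) = faceG i L ++ [x].
Proof.
  revert i; induction L as [|y L IH]; intros i Hi; simpl in Hi; [lia|].
  destruct i as [|i].
  - destruct L as [|z L]; [simpl in Hi; lia|]. reflexivity.
  - transitivity (y :: faceG i (L ++ [x])); [reflexivity|]. rewrite IH by lia. reflexivity.
Qed.

Lemma faceG_end (M : list G) (z x : G) : faceG (length M) (M ++ [z; x]) = M ++ [mul z x].
Proof.
  induction M as [|y M IH]; [reflexivity|].
  transitivity (y :: faceG (length M) (M ++ [z; x])); [reflexivity|]. now rewrite IH.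
Qed.

Lemma cface_rotl (i m : nat) (L : list G) : length L = S m -> (i < m)%nat ->
  cface i (rotl L) = rotl (cface (S i) L).
Proof.
  intros H Hi. destruct L as [|x L]; [easy|]. injection H as H.
  unfold cface. cbn [rotl]. rewrite length_app. cbn [length]. rewrite H.
  rewrite Nat.add_1_r. cbn [pred]. rewrite (proj2 (Nat.ltb_lt _ _) Hi).
  destruct (Nat.ltb_spec (S i) m) as [H1|H1].
  - rewrite faceG_app by lia. reflexivity.
  - destruct (exists_last (l := L)) as (M & z & ->).
    { intros ->; simpl in H; lia. }
    rewrite length_app in H; simpl in H.
    replace i with (length M) by lia. rewrite <- app_assoc. cbn [app].
    rewrite faceG_end. unfold wrap. now rewrite last_last, removelast_last.
Qed.

Lemma cface_last_rotl (m : nat) (L : list G) : length L = S m -> (0 < m)%nat ->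
  cface m (rotl L) = cface 0 L.
Proof.
  intros H Hm. destruct L as [|x [|y L]]; try (simpl in H; lia).
  unfold cface. cbn [rotl app length pred] in *. rewrite length_app. cbn [length].
  replace (length L + 1)%nat with m by lia. rewrite Nat.ltb_irrefl. cbn [Nat.ltb Nat.leb].
  unfold wrap. rewrite last_last, removelast_last. reflexivity.
Qed.

Section Cyclic.
Variables (m : nat) (L : list G).
Hypotheses (HL : length L = S m) (Hm : (0 < m)%nat).

Lemma cface_rot_low (k i : nat) : (i + k <= m)%nat -> cface i (rot k L) = rot k (cface (i + k) L).
Proof.
  revert i; induction k as [|k IH]; intros i H; [now rewrite Nat.add_0_r|].
  change (rot (S k) L) with (rotl (rot k L)).
  rewrite (cface_rotl i m) by (rewrite ?length_rot; lia).
  rewrite IH by lia. now rewrite Nat.add_succ_r.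
Qed.

(** Here the face passes the end of the list, where [cface_last_rotl] uses up one rotation. *)
Lemma cface_rot_high (j p : nat) : (j <= m)%nat -> (p <= m)%nat ->
  cface (m - j) (rot (S (j + p)) L) = rot (j + p) (cface p L).
Proof.
  revert p; induction j as [|j IH]; intros p Hj Hp.
  - change (rot (S (0 + p)) L) with (rotl (rot p L)). rewrite Nat.sub_0_r.
    rewrite cface_last_rotl by (rewrite ?length_rot; lia).
    now rewrite cface_rot_low by lia.
  - change (rot (S (S j + p)) L) with (rotl (rot (S (j + p)) L)).
    rewrite (cface_rotl _ m) by (rewrite ?length_rot; lia).
    replace (S (m - S j)) with (m - j)%nat by lia. now rewrite IH by lia.
Qed.
End Cyclic.

(** The norm operator N, the sum over the powers of the signed cyclic operator. *)
Definition cyc (f : list G -> C) (L : list G) : C :=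
  Csum (fun k => Csign (pred (length L) * k) * f (rot k L)) (length L).

Lemma length_cface (i m : nat) (L : list G) :
  length L = S (S m) -> length (cface i L) = S m.
Proof.
  intros H. unfold cface. destruct (Nat.ltb_spec i (pred (length L))) as [Hi|Hi].
  - unfold faceG. rewrite length_app, length_firstn. cbn [length]. rewrite length_skipn. lia.
  - destruct L as [|x L]; [easy|]. unfold wrap. cbn [length] in *.
    destruct (exists_last (l := L)) as (M & z & ->); [intros ->; easy|].
    rewrite removelast_last. rewrite length_app in H. simpl in H. lia.
Qed.

(* The identity [b N = N b'] of cyclic cohomology. *)
Lemma bG_cyc (f : list G -> C) (L : list G) (q : nat) :
  length L = S (S q) -> bG (cyc f) L = cyc (inner f) L.
Proof.
  intros HL. set (m := S q) in *. assert (Hm : (0 < m)%nat) by (unfold m; lia).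
  pose (b j k := Csign j * (Csign (q * k) * f (rot k (cface j L)))).
  pose (S' k := Csum (fun j => b j k) (S m)).
  pose (P k := Csum (fun j => b j k) k).
  transitivity (Csum S' m).
  - rewrite (bG_cface _ _ _ HL). unfold S'.
    assert (HS : forall n, Csum (fun i => Csign i * cyc f (cface i L)) n =
      Csum (fun k => Csum (fun j => b j k) n) m).
    { induction n as [|n IH].
      - rewrite Csum_0 with (n := m); reflexivity.
      - rewrite Csum_S_r, IH.
        rewrite (Csum_ext (fun k => Csum (fun j => b j k) (S n))
          (fun k => Csum (fun j => b j k) n + b n k)) by (intros k _; exact (Csum_S_r (fun j => b j k) n)).
        rewrite Csum_add. f_equal. unfold cyc. rewrite (length_cface _ q) by assumption.
        cbn [pred]. rewrite <- Csum_scale. reflexivity. }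
    apply HS.
  - unfold cyc. rewrite HL. cbn [pred].
    rewrite (Csum_ext (fun k => Csign (m * k) * inner f (rot k L))
      (fun k => Csum (fun i => Csign (m * k) * (Csign i * f (cface i (rot k L)))) m)).
    2:{ intros k _; cbv beta. rewrite (inner_cface _ _ m) by now rewrite length_rot.
        now rewrite Csum_scale. }
    rewrite Csum_S_l.
    (* Rotation [S k] in [N b'] gives the faces above [k] with rotation [S k] and the faces below
       [k] with rotation [k]; the discrepancy in the partial sums [P] telescopes. *)
    rewrite (Csum_ext (fun k => Csum (fun i => Csign (m * S k) * (Csign i * f (cface i (rot (S k) L)))) m)
      (fun k => S' (S k) + (P k - P (S k)))).
    2:{ intros k Hk; cbv beta. replace m with ((m - k) + k)%nat at 1 by lia. rewrite Csum_split.
      unfold S', P. replace (S m) with (S k + (m - k))%nat by lia.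
      rewrite (Csum_split _ (S k) (m - k)).
      transitivity (Csum (fun i => b (S k + i)%nat (S k)) (m - k) + Csum (fun j => b j k) k); [|ring].
      f_equal; apply Csum_ext; intros i Hi; unfold b.
      - rewrite (cface_rot_low m L HL Hm) by lia. replace (i + S k)%nat with (S k + i)%nat by lia.
        transitivity (Csign (m * S k + i) * f (rot (S k) (cface (S k + i) L))).
        + rewrite Csign_add. ring.
        + rewrite (Csign_parity (m * S k + i) (S k + i + q * S k) 0 0) by (unfold m; lia).
          rewrite (Csign_add (S k + i)). ring.
      - replace (m - k + i)%nat with (m - (k - i))%nat by lia.
        replace (S k) with (S ((k - i) + i)) by lia.
        rewrite (cface_rot_high m L HL Hm) by lia. replace (k - i + i)%nat with k by lia.
        transitivity (Csign (m * S k + (m - (k - i))) * f (rot k (cface i L))).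
        + rewrite Csign_add. ring.
        + rewrite (Csign_parity (m * S k + (m - (k - i))) (i + q * k) 0 m) by (unfold m; lia).
          rewrite Csign_add. ring. }
    rewrite Csum_add, (Csum_telescope P).
    (* A face of [L] has length [m], so [m] rotations are trivial, and their sign is 1 because
       [q * (q + 1)] is even. *)
    assert (Hb : forall j, b j m = b j 0%nat).
    { intros j. unfold b. assert (Hj := rot_length_self (cface j L)).
      rewrite (length_cface _ q) in Hj by assumption.
      change (S q) with m in Hj. rewrite Hj, Nat.mul_0_r.
      assert (Hev : Csign (q * m) = 1); [|rewrite Hev; reflexivity].
      unfold m. destruct (Nat.Even_or_Odd q) as [[c ->]|[c ->]].
      - rewrite <- (Csign_double (c * S (2 * c))). f_equal. lia.
      - rewrite <- (Csign_double ((2 * c + 1) * (c + 1))). f_equal. lia. }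
    assert (HSm : S' m = S' 0%nat) by (apply Csum_ext; auto).
    assert (HP0 : P 0%nat = 0) by reflexivity.
    assert (HPm : P m = S' m - b m m) by (unfold P, S'; rewrite Csum_S_r; ring).
    assert (H0 : Csum (fun i => Csign (m * 0) * (Csign i * f (cface i (rot 0 L)))) m =
      S' 0%nat - b m 0%nat).
    { unfold S'. rewrite Csum_S_r. transitivity (Csum (fun j => b j 0%nat) m); [|ring].
      apply Csum_ext. intros i _. unfold b. rewrite !Nat.mul_0_r. simpl. ring. }
    rewrite H0, HP0, HPm, Hb.
    assert (HSum : Csum (fun k => S' (S k)) m = Csum S' m - S' 0%nat + S' m).
    { assert (E1 := Csum_S_l S' m). assert (E2 := Csum_S_r S' m). rewrite E1 in E2.
      transitivity (S' 0%nat + Csum (fun k => S' (S k)) m - S' 0%nat); [ring|].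
      rewrite E2. ring. }
    rewrite HSum, HSm. ring.
Qed.

Lemma s_bG (f : list G -> C) (L : list G) : L <> [] ->
  bG f (one :: L) = f L - inner (fun Y => f (one :: Y)) L + Csign (length L) * f (wrap (one :: L)).
Proof.
  intros H. destruct L as [|g L]; [easy|]. unfold bG. cbn [length pred].
  change (inner f (one :: g :: L)) with
    (f (mul one g :: L) - inner (fun Y => f (one :: Y)) (g :: L)).
  now rewrite mul_1_l.
Qed.

(** The last face at an inserted unit undoes one rotation: this is [N (1 - c) = 0] for the signed
    cyclic operator [c]. *)
Lemma cyc_wrap (f : list G -> C) (L : list G) (m : nat) : length L = S m ->
  cyc (fun Y => Csign (length Y) * f (wrap (one :: Y))) L = - cyc f L.
Proof.
  intros HL. unfold cyc. rewrite HL. cbn [pred].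
  assert (Hw : forall k, wrap (one :: rot (S k) L) = rot k L).
  { intros k. change (rot (S k) L) with (rotl (rot k L)).
    assert (Hk : length (rot k L) = S m) by now rewrite length_rot.
    destruct (rot k L) as [|x M]; [easy|]. simpl rotl. unfold wrap.
    now rewrite last_last, removelast_last, mul_1_r. }
  rewrite Csum_S_l, (Csum_S_r (fun k => Csign (m * k) * f (rot k L))).
  rewrite (Csum_ext _ (fun k => Copp 1 * (Csign (m * k) * f (rot k L)))).
  2:{ intros k _; cbv beta. rewrite Hw, length_rot, HL.
      rewrite (Csign_parity (m * S k) (m + m * k) 0 0), Csign_S by lia.
      rewrite Csign_add. transitivity (- (Csign m * Csign m) * (Csign (m * k) * f (rot k L))); [ring|].
      rewrite Csign_sq. ring. }
  rewrite Csum_scale.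
  assert (H0 : wrap (one :: rot 0 L) = rot m L).
  { assert (E := Hw m). rewrite <- HL, rot_length_self in E. exact E. }
  rewrite H0, length_rot, HL, Csign_S, Nat.mul_0_r.
  assert (Hm : Csign (m * m) = Csign m).
  { destruct (Nat.Even_or_Odd m) as [[c ->]|[c ->]].
    - apply (Csign_parity _ _ c (2 * c * c)). lia.
    - apply (Csign_parity _ _ 0 ((2 * c + 1) * c)). lia. }
  rewrite Hm. change (Csign 0) with C1. ring.
Qed.

Lemma cyc_add (f g : list G -> C) (L : list G) : cyc (fun Y => f Y + g Y) L = cyc f L + cyc g L.
Proof. unfold cyc. rewrite <- Csum_add. apply Csum_ext. intros; ring. Qed.

Lemma cyc_ext (f g : list G -> C) (L : list G) :
  (forall Y, length Y = length L -> f Y = g Y) -> cyc f L = cyc g L.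
Proof. intros H. unfold cyc. apply Csum_ext. intros. now rewrite H by apply length_rot. Qed.

Lemma cyc_opp (f : list G -> C) (L : list G) : cyc (fun Y => - f Y) L = - cyc f L.
Proof.
  unfold cyc. transitivity (Copp 1 * Csum (fun k => Csign (pred (length L) * k) * f (rot k L)) (length L)).
  - rewrite <- Csum_scale. apply Csum_ext. intros; ring.
  - ring.
Qed.

(* With [s f = f (1, -)] one has [B = N s] and [s b + b' s = 1 - (cyclic operator)]. *)
Lemma cyc_bG (f : list G -> C) (L : list G) (m : nat) : length L = S m ->
  cyc (fun Y => bG f (one :: Y)) L = - cyc (inner (fun Y => f (one :: Y))) L.
Proof.
  intros HL.
  rewrite (cyc_ext _ (fun Y => (f Y + Csign (length Y) * f (wrap (one :: Y))) +
    - inner (fun Y => f (one :: Y)) Y)).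
  - rewrite !cyc_add, cyc_opp, (cyc_wrap _ _ m HL). ring.
  - intros Y HY. rewrite s_bG by (intros ->; simpl in HY; lia). ring.
Qed.

Section Theta.
Variable theta : R.

Lemma ksum_rot (k : nat) (L : list G) : ksum (rot k L) = ksum L.
Proof.
  induction k as [|k IH]; [reflexivity|]. rewrite <- IH.
  change (ksum (rotl (rot k L)) = ksum (rot k L)). destruct (rot k L) as [|x M]; [reflexivity|].
  simpl rotl. rewrite ksum_app. simpl. lia.
Qed.

Lemma connes_B_rot (n : nat) (phi : cochain) (l : list Basis) : length l = S n ->
  connes_B n phi l = Csum (fun i => Csign (n * i) * phi (unitB :: rot i l)) (S n).
Proof.
  intros Hl. unfold connes_B. apply Csum_ext. intros i Hi. now rewrite rot_skipn by lia.
Qed.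

Lemma ext_connes_B (n : nat) (phi : cochain) (L : list G) : length L = S n ->
  ext theta (connes_B n phi) L = cyc (fun Y => ext theta phi (one :: Y)) L.
Proof.
  intros HL. unfold cyc, ext at 1. rewrite connes_B_rot by now rewrite length_map.
  rewrite <- Csum_scale, HL. apply Csum_ext. intros k _. cbn [pred].
  unfold ext. cbn [map]. rewrite map_rot. cbn [ksum fold_right]. fold (ksum (rot k L)).
  rewrite ksum_rot. change (fst one + ksum L)%Z with (ksum L). change (snd one) with unitB. ring.
Qed.

Lemma connes_B_emb (n : nat) (phi : cochain) (l : list Basis) : length l = S n ->
  connes_B n phi l = cyc (fun Y => ext theta phi (one :: Y)) (map emb l).
Proof.
  intros Hl. rewrite <- (ext_connes_B n) by now rewrite length_map. symmetry. apply ext_emb.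
Qed.

Lemma bG_length (f g : list G -> C) (L : list G) (m : nat) : length L = S (S m) ->
  (forall Y, length Y = S m -> f Y = g Y) -> bG f L = bG g L.
Proof.
  intros HL H. rewrite !(bG_cface _ _ _ HL). apply Csum_ext. intros i _.
  rewrite H; [reflexivity|]. now apply length_cface.
Qed.

Lemma connes_B_hoch_b_0 (phi : cochain) (l : list Basis) : length l = 1%nat ->
  connes_B 0 (hoch_b theta 0 phi) l = 0.
Proof.
  intros Hl. rewrite connes_B_emb by assumption.
  rewrite (cyc_ext _ (fun Y => bG (ext theta phi) (one :: Y))).
  - rewrite (cyc_bG _ _ 0) by now rewrite length_map.
    destruct l as [|x [|]]; try easy. unfold cyc, Csum; simpl. ring.
  - intros Y HY. rewrite length_map in HY. apply ext_hoch_b. simpl. lia.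
Qed.

(** With [B = N s], [bG_cyc] gives [b N s = N b' s] and [cyc_bG] gives [N s b = - N b' s]. *)
Lemma b_B_anticommute (n : nat) (phi : cochain) (l : list Basis) : length l = S (S n) ->
  hoch_b theta n (connes_B n phi) l + connes_B (S n) (hoch_b theta (S n) phi) l = 0.
Proof.
  intros Hl. assert (HL : length (map emb l) = S (S n)) by now rewrite length_map.
  rewrite hoch_b_emb by assumption.
  rewrite (bG_length _ _ _ _ HL (fun Y HY => ext_connes_B n phi Y HY)).
  rewrite (bG_cyc _ _ _ HL). rewrite connes_B_emb by assumption.
  rewrite (cyc_ext (fun Y => ext theta (hoch_b theta (S n) phi) (one :: Y))
    (fun Y => bG (ext theta phi) (one :: Y))).
  - rewrite (cyc_bG _ _ _ HL). ring.
  - intros Y HY. apply ext_hoch_b. simpl. lia.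
Qed.

(** The unit inserted by one operator ends up behind the unit inserted by the other, where
    normalized cochains vanish. *)
Lemma connes_B_B (n : nat) (phi : cochain) (l : list Basis) : length l = S n ->
  norm_at (S (S n)) phi -> connes_B n (connes_B (S n) phi) l = 0.
Proof.
  intros Hl Hn. rewrite connes_B_rot by assumption. apply Csum_0. intros i _.
  rewrite connes_B_rot by (cbn [length]; rewrite length_rot; lia).
  rewrite Csum_0; [ring|]. intros j _. rewrite Hn; [ring| |].
  - cbn [length]. rewrite length_rot. cbn [length]. rewrite length_rot. lia.
  - simpl. rewrite In_rot. simpl; auto.
Qed.

Lemma connes_B_norm_at (n : nat) (phi : cochain) :
  norm_at (S n) phi -> norm_at n (connes_B n phi).
Proof.
  intros Hn l Hl Hu. rewrite connes_B_rot by assumption. apply Csum_0. intros j _.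
  rewrite Hn; [ring| |].
  - cbn [length]. rewrite length_rot. lia.
  - simpl. rewrite In_rot. destruct l; simpl in *; auto.
Qed.

Lemma hoch_b_dl (n : nat) (phi : cochain) (g : Basis) (r : list Basis) : length r = S n ->
  hoch_b theta n phi (g :: r) =
  dl (hom (ext theta phi)) (one :: prods one (map emb r))
    (mul (last (prods one (map emb r)) one) (emb g)).
Proof.
  intros Hr. rewrite dl_hom by (cbn [length]; rewrite length_prods, length_map; lia).
  rewrite hom_prods. apply hoch_b_emb. simpl. lia.
Qed.

Lemma hoch_b_b (n : nat) (phi : cochain) (l : list Basis) : length l = S (S (S n)) ->
  hoch_b theta (S n) (hoch_b theta n phi) l = 0.
Proof.
  destruct l as [|g r]; [easy|]. intros Hl; injection Hl as Hl. rewrite hoch_b_dl by assumption.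
  transitivity (dl (dl (hom (ext theta phi))) (one :: prods one (map emb r))
    (mul (last (prods one (map emb r)) one) (emb g))).
  - unfold dl at 1 2. apply del_length. cbn [length pred].
    rewrite length_prods, length_map. intros Y HY. rewrite dl_hom by lia.
    destruct Y as [|x Y]; [easy|]. apply ext_hoch_b. cbn [length] in *. rewrite length_diffs. lia.
  - now rewrite dl_dl.
Qed.

Lemma hoch_b_norm_at (n : nat) (phi : cochain) :
  norm_at n phi -> norm_at (S n) (hoch_b theta n phi).
Proof.
  intros Hn [|g r] Hl Hu; [easy|]. injection Hl as Hl.
  rewrite (hoch_b_ext theta n phi (trunc (S n) phi)), hoch_b_dl by
    (try (intros; symmetry; now apply trunc_eq); cbn [length]; lia).
  apply (reg_n theta).
  - apply regular_dl, hom_regular; [apply ext_twisted|now apply ext_trunc_normal].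
  - apply degen_diffs. rewrite diffs_prods. simpl in Hu. now rewrite map_snd_emb.
Qed.

End Theta.

(** * Periodic cyclic cohomology *)

Definition comb (c : C) (f g : family) : family := fun n l => f n l + c * g n l.

Lemma fam_sub_comb (f g : family) (n : nat) (l : list Basis) :
  fam_sub f g n l = comb (Copp 1) f g n l.
Proof. unfold fam_sub, comb. ring. Qed.

Lemma lin_comb_Csum (k : nat) (a : nat -> C) (c : nat -> family) (n : nat) (l : list Basis) :
  lin_comb k a c n l = Csum (fun i => a i * c i n l) k.
Proof.
  unfold lin_comb, Csum. induction (seq 0 k) as [|i s IH]; [reflexivity|].
  simpl. unfold fam_add at 1. now rewrite IH.
Qed.

Lemma normalized_norm_at (f : family) : normalized f <-> forall n, norm_at n (f n).
Proof.
  split.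
  - intros H n l Hl Hu. apply H; [assumption|].
    destruct l as [|x l]; [easy|]. destruct (In_nth _ _ unitB Hu) as (i & Hi & E).
    simpl in *. exists (S i). repeat split; auto; lia.
  - intros H n l Hl (i & Hi & Hin & E). apply (H n); [assumption|].
    destruct l as [|x l]; [easy|]. destruct i as [|i]; [lia|]. simpl in *. rewrite <- E.
    apply nth_In. lia.
Qed.

Lemma comb_adm (p : bool) (c : C) (f g : family) : adm p f -> adm p g -> adm p (comb c f g).
Proof.
  intros (F1 & F2 & N & F3) (G1 & G2 & M & G3). unfold comb. repeat split.
  - intros n l Hl Hu. rewrite F1, G1 by assumption. ring.
  - intros n l Hl Hu. rewrite F2, G2 by assumption. ring.
  - exists (max N M). intros n l Hn Hl. rewrite F3, G3 by (assumption || lia). ring.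
Qed.

Definition single (k : nat) (h : cochain) : family :=
  fun n l => if Nat.eqb n k then h l else 0.

Lemma single_eq (k : nat) (h : cochain) (l : list Basis) : single k h k l = h l.
Proof. unfold single. now rewrite Nat.eqb_refl. Qed.

Lemma single_neq (k n : nat) (h : cochain) (l : list Basis) : n <> k -> single k h n l = 0.
Proof. intros H. unfold single. now destruct (Nat.eqb_spec n k). Qed.

Lemma single_adm (k : nat) (h : cochain) : norm_at k h -> adm (Nat.even k) (single k h).
Proof.
  intros H. repeat split.
  - apply normalized_norm_at. intros n l Hl Hu. unfold single.
    destruct (Nat.eqb_spec n k) as [->|]; auto.
  - intros n l Hl Hp. apply single_neq. congruence.
  - exists (S k). intros n l Hn Hl. apply single_neq. lia.
Qed.

Section Theta.
Variable theta : R.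

Lemma hoch_b_comb (n : nat) (c : C) (f g : cochain) (l : list Basis) :
  hoch_b theta n (fun l => f l + c * g l) l = hoch_b theta n f l + c * hoch_b theta n g l.
Proof.
  unfold hoch_b.
  rewrite (Csum_ext _ (fun i =>
    (let '(d, l') := face theta i l in Csign i * (d * f l')) +
    c * (let '(d, l') := face theta i l in Csign i * (d * g l')))).
  - rewrite Csum_add, Csum_scale. destruct (last_face theta l). ring.
  - intros i _. destruct (face theta i l). ring.
Qed.

Lemma connes_B_comb (n : nat) (c : C) (f g : cochain) (l : list Basis) :
  connes_B n (fun l => f l + c * g l) l = connes_B n f l + c * connes_B n g l.
Proof.
  unfold connes_B. rewrite <- Csum_scale, <- Csum_add. apply Csum_ext. intros; ring.
Qed.

Lemma total_d_comb (c : C) (f g : family) (n : nat) (l : list Basis) :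
  total_d theta (comb c f g) n l = total_d theta f n l + c * total_d theta g n l.
Proof.
  unfold total_d, comb. rewrite connes_B_comb. destruct n; [|rewrite hoch_b_comb]; ring.
Qed.

Lemma connes_B_ext (n : nat) (phi psi : cochain) (l : list Basis) :
  length l = S n -> (forall l, length l = S (S n) -> phi l = psi l) ->
  connes_B n phi l = connes_B n psi l.
Proof.
  intros Hl H. rewrite !connes_B_rot by assumption. apply Csum_ext. intros.
  rewrite H; [reflexivity|]. cbn [length]. rewrite length_rot. lia.
Qed.

Lemma hoch_b_0 (n : nat) (phi : cochain) (l : list Basis) : length l = S (S n) ->
  (forall l, length l = S n -> phi l = 0) -> hoch_b theta n phi l = 0.
Proof.
  intros Hl H. rewrite (hoch_b_ext theta n phi (fun l => phi l + Copp 1 * phi l)), hoch_b_comb; auto.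
  - ring.
  - intros; rewrite H by assumption; ring.
Qed.

Lemma connes_B_0 (n : nat) (phi : cochain) (l : list Basis) : length l = S n ->
  (forall l, length l = S (S n) -> phi l = 0) -> connes_B n phi l = 0.
Proof.
  intros Hl H. rewrite (connes_B_ext n phi (fun l => phi l + Copp 1 * phi l)), connes_B_comb; auto.
  - ring.
  - intros; rewrite H by assumption; ring.
Qed.

(** Normalization enters through [B^2 = 0]. *)
Lemma total_d_total_d (f : family) (n : nat) (l : list Basis) :
  normalized f -> length l = S n -> total_d theta (total_d theta f) n l = 0.
Proof.
  rewrite normalized_norm_at. intros Hf Hl.
  assert (HB : connes_B n (total_d theta f (S n)) l = connes_B n (hoch_b theta n (f n)) l).
  { transitivity (connes_B n (hoch_b theta n (f n)) l + 1 * connes_B n (connes_B (S n) (f (S (S n)))) l).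
    - rewrite <- connes_B_comb. apply connes_B_ext; [assumption|]. intros. unfold total_d. ring.
    - rewrite connes_B_B by auto. ring. }
  unfold total_d at 1. rewrite HB. destruct n as [|n].
  - rewrite (connes_B_hoch_b_0 theta) by assumption. ring.
  - transitivity (hoch_b theta n (fun l => (match n with O => 0 | S k => hoch_b theta k (f k) l end)
      + 1 * connes_B n (f (S n)) l) l + connes_B (S n) (hoch_b theta (S n) (f (S n))) l).
    + f_equal. apply hoch_b_ext; [assumption|]. intros. unfold total_d. ring.
    + rewrite hoch_b_comb.
      assert (Hbb : hoch_b theta n (fun l => match n with O => 0 | S k => hoch_b theta k (f k) l end) l = 0).
      { destruct n as [|n]; [now apply hoch_b_0|].
        now apply (hoch_b_b theta n (f n)). }
      rewrite Hbb. transitivity (hoch_b theta n (connes_B n (f (S n))) l +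
        connes_B (S n) (hoch_b theta (S n) (f (S n))) l); [ring|].
      now apply b_B_anticommute.
Qed.

Lemma total_d_adm (p : bool) (f : family) : adm p f -> adm (negb p) (total_d theta f).
Proof.
  intros (F1 & F2 & N & F3). repeat split.
  - apply normalized_norm_at. rewrite normalized_norm_at in F1.
    intros n l Hl Hu. unfold total_d. rewrite (connes_B_norm_at n) by auto.
    destruct n as [|n]; [ring|]. rewrite (hoch_b_norm_at theta n) by auto. ring.
  - intros n l Hl Hp. unfold total_d. rewrite connes_B_0.
    + destruct n as [|n]; [ring|]. rewrite hoch_b_0; [ring|assumption|].
      intros l' Hl'. apply F2; [assumption|]. intros E. apply Hp.
      rewrite Nat.even_succ, <- Nat.negb_even. now rewrite E.
    + assumption.
    + intros l' Hl'. apply F2; [assumption|]. intros E. apply Hp.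
      rewrite Nat.even_succ, <- Nat.negb_even in E. rewrite <- E. now rewrite negb_involutive.
  - exists (S N). intros n l Hn Hl. unfold total_d. rewrite connes_B_0.
    + destruct n as [|n]; [ring|]. rewrite hoch_b_0; [ring|assumption|].
      intros. apply F3; [lia|assumption].
    + assumption.
    + intros. apply F3; [lia|assumption].
Qed.

Lemma total_d_single (k : nat) (h : cochain) (n : nat) (l : list Basis) : length l = S n ->
  total_d theta (single k h) n l =
  (if Nat.eqb n (S k) then hoch_b theta k h l else 0) +
  (if Nat.eqb (S n) k then connes_B n h l else 0).
Proof.
  intros Hl. unfold total_d. f_equal.
  - destruct n as [|n]; [reflexivity|]. simpl.
    destruct (Nat.eqb_spec n k) as [->|Hn].
    + apply hoch_b_ext; [assumption|]. intros; apply single_eq.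
    + apply hoch_b_0; [assumption|]. intros; now apply single_neq.
  - destruct (Nat.eqb_spec (S n) k) as [<-|Hn].
    + apply connes_B_ext; [assumption|]. intros; apply single_eq.
    + apply connes_B_0; [assumption|]. intros; now apply single_neq.
Qed.

(** * Reduction to degrees at most 2, and the odd case *)

Hypothesis Hirr : irrational theta.

Lemma hoch_b_of_total_d (f : family) (n : nat) (l : list Basis) : length l = S (S n) ->
  (forall l, length l = S (S (S n)) -> f (S (S n)) l = 0) ->
  total_d theta f (S n) l = hoch_b theta n (f n) l.
Proof.
  intros Hl H. unfold total_d. rewrite (connes_B_0 (S n)); [ring|assumption|assumption].
Qed.

Lemma total_d_0 (n : nat) (l : list Basis) : length l = S n ->
  total_d theta (fun _ _ => 0) n l = 0.
Proof.
  intros Hl. unfold total_d. rewrite connes_B_0 by auto.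
  destruct n; [|rewrite hoch_b_0 by auto]; ring.
Qed.

(** Closedness is asked from degree 3 on because [f] may also be a primitive of a combination of the
    generators, which live in degrees 0 and 2. *)
Lemma reduce_degree (N : nat) (p : bool) (f : family) :
  adm p f -> (forall n l, (3 + N <= n)%nat -> length l = S n -> f n l = 0) ->
  (forall n l, (3 <= n)%nat -> length l = S n -> total_d theta f n l = 0) ->
  exists g, adm (negb p) g /\
    forall n l, (3 <= n)%nat -> length l = S n -> f n l = total_d theta g n l.
Proof.
  revert f; induction N as [|N IH]; intros f Hf HN Hd.
  - exists (fun _ _ => 0). split.
    + split; [|split; [|exists 0%nat]]; repeat intro; auto.
    + intros n l Hn Hl. rewrite HN by (assumption || lia). symmetry. now apply total_d_0.
  - set (k := (2 + N)%nat). assert (Htop : forall l, length l = S (S (S k)) ->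
      hoch_b theta (S k) (f (S k)) l = 0).
    { intros l Hl. rewrite <- (hoch_b_of_total_d f (S k)), Hd; try reflexivity; try assumption; try lia.
      intros l' Hl'. apply HN; [lia|assumption]. }
    destruct (bool_dec (Nat.even (S k)) p) as [Hp|Hp].
    2:{ apply IH; auto. intros n l Hn Hl. destruct (Nat.eq_dec n (S k)) as [->|Hnk].
      - now apply (proj1 (proj2 Hf)).
      - apply HN; [lia|assumption]. }
    (* The component has degree [S k], at least 3, beyond the degree obstructed by [fund]. *)
    destruct (hochschild_exact theta Hirr k (f (S k))) as (h & Hh & Ehb).
    { apply normalized_norm_at, Hf. }
    { assumption. }
    { lia. }
    assert (Hs : adm (negb p) (single k h)).
    { rewrite <- Hp, Nat.even_succ, <- Nat.negb_even, negb_involutive. now apply single_adm. }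
    assert (Hds : adm p (total_d theta (single k h))).
    { rewrite <- (negb_involutive p). now apply total_d_adm. }
    (* This trades the top component for a term [B h] two degrees lower. *)
    destruct (IH (comb (Copp 1) f (total_d theta (single k h)))) as (g & Hg & Eg).
    + now apply comb_adm.
    + intros n l Hn Hl. unfold comb. rewrite total_d_single by assumption.
      destruct (Nat.eqb_spec (S n) k); [lia|].
      destruct (Nat.eqb_spec n (S k)) as [->|Hnk].
      * rewrite Ehb by assumption. ring.
      * rewrite HN by (assumption || lia). ring.
    + intros n l Hn Hl. rewrite total_d_comb, Hd, total_d_total_d by (assumption || apply Hs). ring.
    + exists (comb 1 (single k h) g). split; [now apply comb_adm|].
      intros n l Hn Hl. rewrite total_d_comb, <- Eg by assumption. unfold comb. ring.
Qed.

Lemma total_d_reduced (p : bool) (f : family) :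
  adm p f -> (forall n l, (3 <= n)%nat -> length l = S n -> total_d theta f n l = 0) ->
  exists g, adm (negb p) g /\ adm p (comb (Copp 1) f (total_d theta g)) /\
    forall n l, (3 <= n)%nat -> length l = S n -> comb (Copp 1) f (total_d theta g) n l = 0.
Proof.
  intros Hf Hd. destruct (proj2 (proj2 Hf)) as [N HN].
  destruct (reduce_degree N p f Hf) as (g & Hg & Eg).
  - intros n l Hn. apply HN. lia.
  - assumption.
  - exists g. split; [assumption|split].
    + apply comb_adm; [assumption|]. rewrite <- (negb_involutive p). now apply total_d_adm.
    + intros n l Hn Hl. unfold comb. rewrite Eg by assumption. ring.
Qed.

(** After reduction only degree 1 is left; the primitive found there has degree 0, so no B term has
    to be corrected. *)
Lemma HP_odd : HP_zero theta false.
Proof.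
  intros f [Hf Hd]. split; [assumption|].
  destruct (total_d_reduced false f Hf) as (g & Hg & Hf1 & E1); [intros; now apply Hd|].
  set (f1 := comb (Copp 1) f (total_d theta g)) in *.
  destruct (hochschild_exact theta Hirr 0 (f1 1%nat)) as (h & Hh & Ehb).
  - apply normalized_norm_at, Hf1.
  - intros l Hl. rewrite <- hoch_b_of_total_d by auto.
    unfold f1. rewrite total_d_comb, total_d_total_d, Hd by (assumption || apply Hg). ring.
  - easy.
  - assert (Hs : adm true (single 0 h)) by (now apply single_adm).
    exists (comb 1 g (single 0 h)). split; [now apply comb_adm|].
    intros n l Hl. rewrite total_d_comb, total_d_single by assumption.
    transitivity (total_d theta g n l + f1 n l); [unfold f1, comb; ring|].
    f_equal. destruct n as [|[|[|n]]]; simpl Nat.eqb; cbv iota.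
    + rewrite (proj1 (proj2 Hf1)); [ring|assumption|easy].
    + rewrite Ehb by assumption. ring.
    + rewrite (proj1 (proj2 Hf1)); [ring|assumption|easy].
    + rewrite E1 by (assumption || lia). ring.
Qed.

(** * The fundamental cycle and the area cocycle *)

Lemma hom_comb (c : C) (f g : list G -> C) (X : list G) (a : G) :
  hom (fun L => f L + c * g L) X a = hom f X a + c * hom g X a.
Proof. destruct X; simpl; ring. Qed.

Lemma fund_comb (c : C) (phi psi : cochain) :
  fund (ext theta (fun l => phi l + c * psi l)) = fund (ext theta phi) + c * fund (ext theta psi).
Proof.
  transitivity (fund (fun L => ext theta phi L + c * ext theta psi L)).
  - f_equal. apply functional_extensionality. intros L. unfold ext. ring.
  - unfold fund. rewrite !hom_comb. ring.
Qed.

Lemma fund_ext (phi psi : cochain) : (forall l, length l = 3%nat -> phi l = psi l) ->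
  fund (ext theta phi) = fund (ext theta psi).
Proof. intros H. unfold fund, hom, ext. rewrite !H by reflexivity. reflexivity. Qed.

(** The two triangles form a square whose opposite edges are translates of each other and whose
    diagonals end at [U2 U1] and [U1 U2], equal up to [z]; all edges cancel. *)
Lemma fund_hoch_b (phi : cochain) : norm_at 1 phi -> fund (ext theta (hoch_b theta 1 phi)) = 0.
Proof.
  intros Hn. pose (F := hom (ext theta (trunc 2 phi))).
  assert (HF : regular theta F).
  { apply hom_regular; [apply ext_twisted|now apply ext_trunc_normal]. }
  assert (Hinv : forall g, tr g F = F) by apply hom_invariant.
  assert (Hg : forall g x y, F [mul g x; mul g y] one = F [x; y] one).
  { intros g x y. assert (e := equal_f (equal_f (Hinv g) [x; y]) one).
    unfold tr in e. rewrite conj_central in e by reflexivity. exact e. }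
  assert (E : forall x y z, hom (ext theta (hoch_b theta 1 phi)) [x; y; z] one =
    F [y; z] one - (F [x; z] one - F [x; y] one)).
  { intros x y z. transitivity (dl F [x; y; z] one).
    - unfold F. rewrite dl_hom by (simpl; lia). unfold hom.
      rewrite <- ext_hoch_b with (n := 1%nat) by reflexivity. unfold ext. f_equal.
      apply hoch_b_ext; [reflexivity|]. intros; symmetry; now apply trunc_eq.
    - unfold dl. cbn [del]. clearbody F. ring. }
  unfold fund. rewrite !E.
  assert (e1 := Hg U2 one U1). assert (e2 := Hg U1 one U2). rewrite mul_1_r in e1, e2.
  rewrite e1, e2.
  rewrite (reg_snd theta F [one; mul U2 U1] [one; mul U1 U2] one HF) by reflexivity.
  clearbody F. ring.
Qed.

Definition central (a : Basis) : bool :=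
  let '(n, m, e) := a in ((n =? 0)%Z && (m =? 0)%Z && negb e)%bool.

Lemma central_spec (a : Basis) : central a = true <-> a = unitB.
Proof.
  destruct a as [[n m] e]. unfold central, unitB.
  rewrite !andb_true_iff, !Z.eqb_eq, negb_true_iff. split.
  - intros [[-> ->] ->]. reflexivity.
  - intros E; injection E as -> -> ->. auto.
Qed.

(** Twice the oriented area of a triangle, and zero on other lengths so that the form lives in
    degree 2 alone. *)
Definition area (X : list Basis) : Z :=
  match X with
  | [(x0, y0, _); (x1, y1, _); (x2, y2, _)] =>
      ((x1 - x0) * (y2 - y0) - (x2 - x0) * (y1 - y0))%Z
  | _ => 0%Z
  end.

Definition area_form : fn := fun X a =>
  if central (snd a) then lam_pow theta (fst a) * (IZR (area (map snd X)), 0%R) else 0.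

Lemma area_form_regular : regular theta area_form.
Proof.
  split; unfold area_form.
  - intros X X' a k E. rewrite E. simpl. destruct (central (snd a)); [|ring].
    rewrite lam_pow_add. ring.
  - intros X a Hd. destruct (central (snd a)); [|reflexivity].
    assert (E : area (map snd X) = 0%Z); [|rewrite E; change (0%R, 0%R) with C0; ring].
    destruct X as [|[? [[? ?] ?]] [|[? [[? ?] ?]] [|[? [[? ?] ?]] [|]]]]; try reflexivity.
    simpl in Hd. destruct Hd as [H|[H|[[]|[]]]]; injection H as -> -> ->; simpl; ring.
Qed.

(** [g] acts on the coordinates of vertices by an affine map with linear part 1 or -1, of
    determinant 1 in the plane, and conjugation fixes central arguments. *)
Lemma area_form_invariant (g : G) : tr g area_form = area_form.
Proof.
  fn_ext. unfold tr, area_form.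
  assert (Hc : central (snd (conj g a)) = central (snd a)).
  { apply eq_true_iff_eq. rewrite !central_spec. split; intros H.
    - assert (E : conj (inv g) (conj g a) = a).
      { rewrite <- conj_mul, mul_inv_l. G_eq. }
      rewrite conj_central in E by assumption. congruence.
    - now rewrite conj_central. }
  rewrite Hc. destruct (central (snd a)) eqn:Ha; [|reflexivity].
  rewrite conj_central by (now apply central_spec). f_equal. f_equal. f_equal.
  destruct g as [? [[? ?] []]];
    destruct X as [|[? [[? ?] ?]] [|[? [[? ?] ?]] [|[? [[? ?] ?]] [|]]]]; try reflexivity;
    simpl; ring.
Qed.

Lemma area_form_closed : dl area_form = f0.
Proof.
  fn_ext. unfold dl, f0. destruct (Nat.eq_dec (length X) 4) as [H4|H4].
  - destruct X as [|[? [[? ?] ?]] [|[? [[? ?] ?]] [|[? [[? ?] ?]] [|[? [[? ?] ?]] [|]]]]]; try easy.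
    unfold area_form; simpl. destruct (central (snd a)); [|ring].
    destruct (lam_pow theta (fst a)) as [u v]. unfold Csub, Cadd, Copp, Cmul, C0. simpl.
    rewrite ?minus_IZR, ?mult_IZR, ?minus_IZR. f_equal; ring.
  - destruct X as [|x X]; [reflexivity|].
    rewrite (del_length _ (fun _ => 0)); [apply del_0|].
    intros Y HY. unfold area_form. assert (E : area (map snd Y) = 0%Z).
    { destruct Y as [|[? [[? ?] ?]] [|[? [[? ?] ?]] [|[? [[? ?] ?]] [|]]]]; try reflexivity.
      simpl in *. lia. }
    rewrite E. destruct (central (snd a)); [|reflexivity]. change (0%R, 0%R) with C0. ring.
Qed.

(* Connes' cyclic 2-cocycle of the torus, [tau (a0 (d1 a1 d2 a2 - d2 a1 d1 a2))]. *)
Definition torus_cocycle : cochain := cob area_form.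

Lemma torus_cocycle_norm_at : norm_at 2 torus_cocycle.
Proof. apply (cob_norm_at theta), area_form_regular. Qed.

Lemma hoch_b_torus_cocycle (l : list Basis) : length l = 4%nat ->
  hoch_b theta 2 torus_cocycle l = 0.
Proof.
  destruct l as [|g r]; [easy|]. intros Hl; injection Hl as Hl. unfold torus_cocycle.
  rewrite hoch_b_cob, area_form_closed by
    (auto using area_form_regular, area_form_invariant). reflexivity.
Qed.

(** With a unit in the first slot the triangle is [1, x, xy], and the form is supported where [xy]
    is central; its last vertex then returns to the first. *)
Lemma connes_B_torus_cocycle (l : list Basis) : length l = 2%nat ->
  connes_B 1 torus_cocycle l = 0.
Proof.
  intros Hl. rewrite connes_B_rot by assumption. apply Csum_0. intros i _.
  assert (H2 : length (rot i l) = 2%nat) by now rewrite length_rot.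
  destruct (rot i l) as [|x [|y [|]]]; try easy.
  unfold torus_cocycle, cob, inh, area_form. cbn [map prods last].
  destruct (central _) eqn:E; [|ring].
  apply central_spec in E. change (emb unitB) with one in E. rewrite mul_1_r in E.
  rewrite E. destruct (snd (mul one (emb x))) as [[? ?] ?]. simpl area.
  match goal with |- context [IZR ?z] => replace z with 0%Z by ring end.
  change (0%R, 0%R) with C0. ring.
Qed.

(** The two triangles have opposite orientations, contributing -1 and 1, and [fund] takes their
    difference. *)
Lemma fund_torus_cocycle : fund (ext theta torus_cocycle) = - (1 + 1).
Proof.
  unfold fund. replace (ext theta torus_cocycle) with (inh area_form).
  - rewrite !hom_inh by (easy || apply area_form_invariant).
    unfold area_form. simpl. rewrite lam_pow_0.
    change ((0 - 0) * (1 + 0 - 0) - (0 + 1 - 0) * (1 - 0))%Z with (-1)%Z.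
    change ((1 - 0) * (0 + 1 - 0) - (1 + 0 - 0) * (0 - 0))%Z with 1%Z.
    unfold Csub, Cadd, Copp, Cmul, C0, C1. simpl. f_equal; ring.
  - apply functional_extensionality. intros L. symmetry. apply ext_cob, area_form_regular.
Qed.

(** * Traces *)

Definition parity_class (n m : Z) : nat := Z.to_nat (n mod 2 + 2 * (m mod 2)).

(** For [r] and [s] in {0, 1}, conjugating [U1^r U2^s t] by [U1^p U2^q] gives
    [lambda^(n m / 2) U1^n U2^m t] with [n = 2p + r], [m = 2q + s] and division rounded down; this
    is the origin of the exponent. Index 4 is the canonical trace. *)
Definition trace (i : nat) : cochain := fun l =>
  match l with
  | [(n, m, e)] =>
      if e then if Nat.eqb (parity_class n m) i then lam_pow theta (- (n * m / 2)) else 0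
      else if (Nat.eqb i 4 && (n =? 0)%Z && (m =? 0)%Z)%bool then 1 else 0
  | _ => 0
  end.

Definition trace_rep (i : nat) : Basis :=
  match i with
  | 0%nat => (0%Z, 0%Z, true)
  | 1%nat => (1%Z, 0%Z, true)
  | 2%nat => (0%Z, 1%Z, true)
  | 3%nat => (1%Z, 1%Z, true)
  | _ => unitB
  end.

Lemma hoch_b_pair (phi : cochain) (x y : Basis) : hoch_b theta 0 phi [x; y] =
  ext theta phi [mul (emb x) (emb y)] - ext theta phi [mul (emb y) (emb x)].
Proof.
  rewrite hoch_b_emb by reflexivity. unfold bG, wrap, inner. simpl map.
  cbn [length pred last removelast]. unfold Csign. simpl Nat.even. cbv iota. ring.
Qed.

Lemma ext_single (phi : cochain) (x : G) :
  ext theta phi [x] = lam_pow theta (fst x) * phi [snd x].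
Proof. unfold ext. simpl. now rewrite Z.add_0_r. Qed.

Lemma hoch_b_trace (i : nat) (l : list Basis) : length l = 2%nat -> hoch_b theta 0 (trace i) l = 0.
Proof.
  destruct l as [|x [|y [|]]]; try easy. intros _. rewrite hoch_b_pair, !ext_single.
  assert (Hmod : forall u v w : Z, u = (v + w * 2)%Z -> (u mod 2 = v mod 2)%Z).
  { intros u v w ->. apply Z.mod_add. lia. }
  (* The two products [n * m] to be compared differ by an even number, so halving respects their
     difference despite rounding. *)
  assert (Hdiv : forall u v k : Z, u = (v + k * 2)%Z -> (u / 2 = v / 2 + k)%Z).
  { intros u v k ->. apply Z.div_add. lia. }
  assert (Htw : forall j j' n m n' m' p q : Z, n = (n' + p * 2)%Z -> m = (m' + q * 2)%Z ->
    (j - (n * m) / 2 = j' - (n' * m') / 2)%Z ->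
    lam_pow theta j * trace i [(n, m, true)] - lam_pow theta j' * trace i [(n', m', true)] = 0).
  { intros j j' n m n' m' p q Hn Hm Hj. unfold trace.
    assert (Hc : parity_class n m = parity_class n' m').
    { unfold parity_class. now rewrite (Hmod n n' p), (Hmod m m' q). }
    rewrite Hc. destruct (Nat.eqb (parity_class n' m') i); [|ring].
    rewrite <- !lam_pow_add. replace (j' + - (n' * m' / 2))%Z with (j + - (n * m / 2))%Z by lia.
    ring. }
  assert (Hun : forall j j' n m n' m' : Z,
    ((n = 0 /\ m = 0)%Z <-> (n' = 0 /\ m' = 0)%Z) -> ((n = 0 /\ m = 0)%Z -> j = j') ->
    lam_pow theta j * trace i [(n, m, false)] - lam_pow theta j' * trace i [(n', m', false)] = 0).
  { intros j j' n m n' m' Hz Hj. unfold trace.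
    destruct (Nat.eqb i 4); simpl; [|ring].
    destruct (Z.eqb_spec n 0), (Z.eqb_spec m 0), (Z.eqb_spec n' 0), (Z.eqb_spec m' 0); simpl;
      try ring; try (exfalso; lia); rewrite Hj by auto; ring. }
  destruct x as [[a b] []], y as [[c d] []]; cbn [mul emb flip xorb fst snd].
  - apply Hun; [lia|]. intros [H1 H2]. replace c with a by lia. replace d with b by lia. ring.
  - apply (Htw _ _ _ _ _ _ (- c)%Z (- d)%Z); try ring.
    rewrite (Hdiv ((a + - c) * (b + - d))%Z ((c + a) * (d + b))%Z (- (c * b + a * d))%Z) by ring.
    ring.
  - apply (Htw _ _ _ _ _ _ a b); try ring.
    rewrite (Hdiv ((a + c) * (b + d))%Z ((c + - a) * (d + - b))%Z (a * d + c * b)%Z) by ring.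
    ring.
  - apply Hun; [lia|]. intros [H1 H2]. replace c with (- a)%Z by lia.
    replace d with (- b)%Z by lia. ring.
Qed.

(** A trace is constant on conjugates, hence determined by one representative of each parity class
    and by the unit; the other untwisted monomials are conjugate to proper multiples of
    themselves. *)
Lemma trace_eq (phi : cochain) (x : Basis) :
  (forall l, length l = 2%nat -> hoch_b theta 0 phi l = 0) ->
  phi [x] = Csum (fun i => phi [trace_rep i] * trace i [x]) 5.
Proof.
  intros Hb. destruct x as [[n m] e].
  change (phi [(n, m, e)] = Csum (fun i => phi [trace_rep i] * trace i [(n, m, e)]) 5).
  assert (Htr : forall x y, ext theta phi [mul x y] = ext theta phi [mul y x]).
  { intros x y. apply Csub_diag_eq.
    transitivity (bG (ext theta phi) [x; y]).
    - unfold bG, wrap. simpl. unfold Csign. simpl. ring.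
    - rewrite <- (ext_hoch_b theta 0) by reflexivity. unfold ext. rewrite Hb by reflexivity. ring. }
  assert (Hconj : forall g a, ext theta phi [conj g a] = ext theta phi [a]).
  { intros g a. unfold conj. rewrite Htr, mul_assoc, mul_inv_l, mul_1_l. reflexivity. }
  unfold Csum. cbn [seq map fold_right trace trace_rep]. destruct e.
  - assert (E : phi [(n, m, true)] =
      lam_pow theta (- (n * m / 2)) * phi (@cons Basis (n mod 2, m mod 2, true)%Z [])).
    { assert (H := Hconj (emb (n / 2, m / 2, false)%Z) (emb (n mod 2, m mod 2, true)%Z)).
      rewrite !ext_single in H.
      assert (Hn := Z.div_mod n 2 ltac:(lia)). assert (Hm := Z.div_mod m 2 ltac:(lia)).
      assert (Bn := Z.mod_pos_bound n 2 ltac:(lia)). assert (Bm := Z.mod_pos_bound m 2 ltac:(lia)).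
      set (p := (n / 2)%Z) in *. set (i := (n mod 2)%Z) in *.
      set (q := (m / 2)%Z) in *. set (j := (m mod 2)%Z) in *.
      assert (Ec : conj (emb (p, q, false)) (emb (i, j, true)) =
        ((n * m / 2)%Z, (n, m, true))).
      { assert (Ek : (n * m / 2 = 2 * p * q + p * j + q * i)%Z).
        { rewrite Hn, Hm.
          replace ((2 * p + i) * (2 * q + j))%Z with (i * j + (2 * p * q + p * j + q * i) * 2)%Z by ring.
          rewrite Z.div_add by lia. replace (i * j / 2)%Z with 0%Z; [ring|].
          symmetry. apply Z.div_small. nia. }
        rewrite Ek. unfold conj, mul, inv, emb, flip; simpl.
        repeat match goal with |- (_, _) = (_, _) => apply f_equal2 end; try reflexivity; lia. }
      rewrite Ec in H. cbn [fst snd emb] in H. rewrite lam_pow_0 in H.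
      transitivity (lam_pow theta (- (n * m / 2)) * (lam_pow theta (n * m / 2) * phi [(n, m, true)])).
      - transitivity ((lam_pow theta (- (n * m / 2)) * lam_pow theta (n * m / 2)) * phi [(n, m, true)]).
        + rewrite lam_pow_opp. ring.
        + ring.
      - change (lam_pow theta (n * m / 2) * phi [(n, m, true)] = 1 * phi (@cons Basis (i, j, true) [])) in H.
        rewrite H. ring. }
    rewrite E. unfold parity_class. simpl andb.
    assert (Hn : (n mod 2 = 0 \/ n mod 2 = 1)%Z) by (assert (B := Z.mod_pos_bound n 2 ltac:(lia)); lia).
    assert (Hm : (m mod 2 = 0 \/ m mod 2 = 1)%Z) by (assert (B := Z.mod_pos_bound m 2 ltac:(lia)); lia).
    destruct Hn as [-> | ->], Hm as [-> | ->];
      match goal with |- context [Z.to_nat ?z] =>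
        let v := eval compute in (Z.to_nat z) in change (Z.to_nat z) with v end; simpl; ring.
  - cbn [Nat.eqb andb].
    destruct (Z.eqb_spec n 0) as [->|Hn].
    + destruct (Z.eqb_spec m 0) as [->|Hm].
      { change (phi [(0%Z, 0%Z, false)]) with (phi [unitB]). simpl. ring. }
      assert (H := Hconj U1 (emb (0%Z, m, false))). rewrite !ext_single in H.
      assert (E : conj U1 (emb (0%Z, m, false)) = ((- m)%Z, (0%Z, m, false))).
      { rewrite conj_U1_untwisted by reflexivity. unfold zpow, coord2, emb; simpl. f_equal. ring. }
      rewrite E in H. cbn [fst snd emb] in H. rewrite lam_pow_0 in H.
      simpl. transitivity C0; [|ring].
      apply (Cmul_neq_0 (lam_pow theta (- m) - 1)); [apply lam_pow_neq_1; [assumption|lia]|].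
      transitivity (lam_pow theta (- m) * phi [(0%Z, m, false)] - 1 * phi [(0%Z, m, false)]); [ring|].
      change (lam_pow theta (- m) * phi [(0%Z, m, false)] = 1 * phi [(0%Z, m, false)]) in H.
      rewrite H. ring.
    + assert (H := Hconj U2 (emb (n, m, false))). rewrite !ext_single in H.
      assert (E : conj U2 (emb (n, m, false)) = (n, (n, m, false))).
      { rewrite conj_U2_untwisted by reflexivity. unfold zpow, coord1, emb; simpl. f_equal. ring. }
      rewrite E in H. cbn [fst snd emb] in H. rewrite lam_pow_0 in H.
      simpl. transitivity C0; [|ring].
      apply (Cmul_neq_0 (lam_pow theta n - 1)); [apply lam_pow_neq_1; [assumption|lia]|].
      transitivity (lam_pow theta n * phi [(n, m, false)] - 1 * phi [(n, m, false)]); [ring|].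
      change (lam_pow theta n * phi [(n, m, false)] = 1 * phi [(n, m, false)]) in H.
      rewrite H. ring.
Qed.

(** * The basis of the even cohomology *)

Definition generator (i : nat) : family :=
  if Nat.eqb i 5 then single 2 torus_cocycle else single 0 (trace i).

Lemma generator_cocycle (i : nat) : HP_cocycle theta true (generator i).
Proof.
  unfold generator. destruct (Nat.eqb i 5); split.
  - apply (single_adm 2), torus_cocycle_norm_at.
  - intros n l Hl. rewrite total_d_single by assumption.
    destruct n as [|[|[|[|n]]]]; simpl Nat.eqb; cbv iota; try ring.
    + rewrite connes_B_torus_cocycle by assumption. ring.
    + rewrite hoch_b_torus_cocycle by assumption. ring.
  - apply (single_adm 0). intros l Hl Hu. destruct l as [|x [|]]; easy.
  - intros n l Hl. rewrite total_d_single by assumption.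
    destruct n as [|[|n]]; simpl Nat.eqb; cbv iota; try ring.
    rewrite hoch_b_trace by assumption. ring.
Qed.

Lemma lin_comb_generator (a : nat -> C) (n : nat) (l : list Basis) :
  lin_comb 6 a generator n l =
  (if Nat.eqb n 0 then Csum (fun i => a i * trace i l) 5 else 0) +
  (if Nat.eqb n 2 then a 5%nat * torus_cocycle l else 0).
Proof.
  rewrite lin_comb_Csum, Csum_S_r.
  rewrite (Csum_ext _ (fun i => (if Nat.eqb n 0 then 1 else 0) * (a i * trace i l))), Csum_scale.
  - change (generator 5 n l) with (if Nat.eqb n 2 then torus_cocycle l else 0).
    destruct (Nat.eqb n 0), (Nat.eqb n 2); ring.
  - intros i Hi. unfold generator. rewrite (proj2 (Nat.eqb_neq i 5)) by lia. unfold single.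
    destruct (Nat.eqb n 0); ring.
Qed.

Lemma lin_comb_adm (a : nat -> C) : adm true (lin_comb 6 a generator).
Proof.
  assert (H : forall k, adm true (fun n l => Csum (fun i => a i * generator i n l) k)).
  { induction k as [|k IH].
    - unfold Csum; simpl. split; [|split; [|exists 0%nat]]; repeat intro; auto.
    - assert (E : (fun n l => Csum (fun i => a i * generator i n l) (S k)) =
        comb (a k) (fun n l => Csum (fun i => a i * generator i n l) k) (generator k)).
      { apply functional_extensionality; intros n; apply functional_extensionality; intros l.
        apply Csum_S_r. }
      rewrite E. apply comb_adm; [assumption|apply generator_cocycle]. }
  assert (E : lin_comb 6 a generator = fun n l => Csum (fun i => a i * generator i n l) 6).
  { apply functional_extensionality; intros n; apply functional_extensionality; intros l.
    apply lin_comb_Csum. }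
  rewrite E. apply H.
Qed.

(** A primitive reduces to one cochain of degree 1. Evaluation on the fundamental cycle gives
    [a 5 = 0]; the cochain is then [b h], and [B b h = 0] leaves a vanishing combination of traces,
    which the representatives separate. *)
Lemma generator_independent (a : nat -> C) :
  HP_coboundary theta true (lin_comb 6 a generator) -> forall i, (i < 6)%nat -> a i = 0.
Proof.
  intros [_ (g & Hg & E)].
  destruct (total_d_reduced false g Hg) as (k & Hk & Hg1 & E1).
  { intros n l Hn Hl. rewrite <- E, lin_comb_generator by assumption.
    destruct n as [|[|[|n]]]; try lia. simpl Nat.eqb; cbv iota. ring. }
  set (g1 := comb (Copp 1) g (total_d theta k)) in *.
  assert (Ed : forall n l, length l = S n -> total_d theta g1 n l = lin_comb 6 a generator n l).
  { intros n l Hl. unfold g1. rewrite total_d_comb, <- E, total_d_total_d by (assumption || apply Hk).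
    ring. }
  assert (Hb : forall l, length l = 3%nat -> hoch_b theta 1 (g1 1%nat) l = a 5%nat * torus_cocycle l).
  { intros l Hl. rewrite <- hoch_b_of_total_d, Ed, lin_comb_generator by auto.
    simpl Nat.eqb; cbv iota. ring. }
  assert (Hn1 : norm_at 1 (g1 1%nat)) by apply normalized_norm_at, Hg1.
  assert (H5 : a 5%nat = 0).
  { apply (Cmul_neq_0 (- (1 + 1))).
    - exact Cneg2_neq_0.
    - transitivity (fund (ext theta (fun l => (fun _ => 0) l + a 5%nat * torus_cocycle l))).
      + rewrite fund_comb, fund_torus_cocycle. unfold fund, hom, ext. cbv beta iota. ring.
      + transitivity (fund (ext theta (hoch_b theta 1 (g1 1%nat)))); [|now apply fund_hoch_b].
        apply fund_ext. intros l Hl. rewrite Hb by assumption. ring. }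
  destruct (hochschild_exact theta Hirr 0 (g1 1%nat)) as (h & Hh & Ehb).
  { assumption. }
  { intros l Hl. rewrite Hb, H5 by assumption. ring. }
  { easy. }
  assert (H0 : forall x, Csum (fun i => a i * trace i [x]) 5 = 0).
  { intros x. transitivity (lin_comb 6 a generator 0%nat [x]).
    - rewrite lin_comb_generator. simpl Nat.eqb; cbv iota. ring.
    - rewrite <- Ed by reflexivity. unfold total_d.
      rewrite (connes_B_ext 0 (g1 1%nat) (hoch_b theta 0 h)).
      + rewrite (connes_B_hoch_b_0 theta) by reflexivity. ring.
      + reflexivity.
      + intros; symmetry; now apply Ehb. }
  intros i Hi. destruct (Nat.eq_dec i 5) as [->|Hi5]; [assumption|].
  rewrite <- (H0 (trace_rep i)).
  destruct i as [|[|[|[|[|i]]]]]; try lia; unfold Csum, trace, trace_rep, parity_class, unitB; simpl;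
    change (- 0)%Z with 0%Z; rewrite ?lam_pow_0; ring.
Qed.

Lemma generator_spans (f : family) : HP_cocycle theta true f ->
  exists a, HP_coboundary theta true (fam_sub f (lin_comb 6 a generator)).
Proof.
  intros [Hf Hd].
  destruct (total_d_reduced true f Hf) as (g & Hg & Hf1 & E1); [intros; now apply Hd|].
  set (f1 := comb (Copp 1) f (total_d theta g)) in *.
  assert (Hd1 : forall n l, length l = S n -> total_d theta f1 n l = 0).
  { intros n l Hl. unfold f1. rewrite total_d_comb, Hd, total_d_total_d by (assumption || apply Hg).
    ring. }
  (* Division by the value -2 of the torus cocycle, so that the corrected component is zero on the
     fundamental cycle. *)
  pose (a5 := fund (ext theta (f1 2%nat)) * Cinv (- (1 + 1))).
  destruct (hochschild_exact theta Hirr 1 (fun l => f1 2%nat l + (- a5) * torus_cocycle l))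
    as (h & Hh & Ehb).
  { intros l Hl Hu. rewrite torus_cocycle_norm_at by assumption.
    rewrite (proj1 (normalized_norm_at f1) (proj1 Hf1)) by assumption. ring. }
  { intros l Hl. rewrite hoch_b_comb, hoch_b_torus_cocycle by assumption.
    rewrite <- hoch_b_of_total_d, Hd1 by auto. ring. }
  { intros _. rewrite fund_comb, fund_torus_cocycle. unfold a5.
    transitivity (fund (ext theta (f1 2%nat)) * (1 - Cinv (- (1 + 1)) * - (1 + 1))); [ring|].
    rewrite (Cinv_l _ Cneg2_neq_0). ring. }
  assert (Hs : adm false (single 1 h)) by (now apply (single_adm 1)).
  (* The component [f1 0] need not be a trace. Subtracting [B h] makes it one, since b and B
     anticommute and [B] kills the torus cocycle. *)
  assert (Ht : forall l, length l = 2%nat -> hoch_b theta 0 (fun l => f1 0%nat l +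
    (Copp 1) * connes_B 0 h l) l = 0).
  { intros l Hl. rewrite hoch_b_comb.
    assert (Eb := b_B_anticommute theta 0 h l Hl).
    assert (E2 : connes_B 1 (hoch_b theta 1 h) l = connes_B 1 (f1 2%nat) l).
    { rewrite (connes_B_ext 1 _ (fun l => f1 2%nat l + (- a5) * torus_cocycle l)) by auto.
      rewrite connes_B_comb, connes_B_torus_cocycle by assumption. ring. }
    rewrite E2 in Eb. assert (Ed := Hd1 1%nat l Hl). unfold total_d in Ed.
    transitivity (hoch_b theta 0 (f1 0%nat) l + connes_B 1 (f1 2%nat) l -
      (hoch_b theta 0 (connes_B 0 h) l + connes_B 1 (f1 2%nat) l)); [ring|].
    rewrite Ed, Eb. ring. }
  pose (a i := if Nat.eqb i 5 then a5 else f1 0%nat [trace_rep i] + Copp 1 * connes_B 0 h [trace_rep i]).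
  exists a. split.
  - assert (E : fam_sub f (lin_comb 6 a generator) = comb (Copp 1) f (lin_comb 6 a generator)).
    { apply functional_extensionality; intros n; apply functional_extensionality; intros l.
      apply fam_sub_comb. }
    rewrite E. apply comb_adm; [assumption|apply lin_comb_adm].
  - exists (comb 1 g (single 1 h)). split; [now apply comb_adm|].
    intros n l Hl. rewrite fam_sub_comb. unfold comb at 1.
    rewrite total_d_comb, total_d_single, lin_comb_generator by assumption.
    assert (Ef : f n l = total_d theta g n l + f1 n l) by (unfold f1, comb; ring).
    rewrite Ef. destruct n as [|[|[|n]]]; simpl Nat.eqb; cbv iota.
    + destruct l as [|x [|]]; try easy.
      assert (Et := trace_eq _ x Ht). cbv beta in Et.
      transitivity (total_d theta g 0%nat [x] + (f1 0%nat [x] +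
        Copp 1 * connes_B 0 h [x]) + connes_B 0 h [x] -
        Csum (fun i => a i * trace i [x]) 5); [ring|].
      rewrite Et. rewrite (Csum_ext (fun i => a i * trace i [x])
        (fun i => (f1 0%nat [trace_rep i] + Copp 1 * connes_B 0 h [trace_rep i]) * trace i [x])).
      * ring.
      * intros i Hi. unfold a. now rewrite (proj2 (Nat.eqb_neq i 5)) by lia.
    + rewrite (proj1 (proj2 Hf1)); [ring|assumption|easy].
    + rewrite Ehb by assumption. unfold a. simpl Nat.eqb; cbv iota. ring.
    + rewrite E1 by (assumption || lia). ring.
Qed.

End Theta.

Theorem theorem2 (theta : R) (Hirr : irrational theta) :
  HP_iso_Cn theta true 6 /\ HP_zero theta false.
Proof.
  split; [|now apply HP_odd].
  exists (generator theta). split; [|split].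
  - intros i _. apply generator_cocycle.
  - now apply generator_independent.
  - now apply generator_spans.
Qed.
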